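(* Let $M$ be a connected Riemann surface and let $\varphi:M\to G_k(\mathbb{C}^n)$ be a harmonic map of finite uniton number and finite isotropy order, with first return map $\mathbf{c}$ of nilorder $2$ and rank $2$, and second return map $\mathbf{e}$. Set $\eta=\operatorname{Im}\bigl((\mathbf{c}\circ\mathbf{e})|_{\operatorname{Im}\mathbf{c}}\bigr)$ and define a bundle map $\mathbf{F}:\eta\to\eta$ by $$\mathbf{F}=\mathbf{c}\circ\mathbf{e}\circ\mathbf{c}\circ\mathbf{e}^2|_\eta .$$ Then $\mathbf{F}$ is nilpotent, and so is zero.
   Context: $M$ is a connected Riemann surface (not necessarily compact), $z$ a local complex coordinate, $\partial_z,\partial_{\bar z}$ the ordinary (flat) derivatives in $\mathbb{C}^n$. A smooth map $\varphi:M\to G_k(\mathbb{C}^n)$ is identified with the rank-$k$ subbundle of $M\times\mathbb{C}^n$ with fibre $\varphi(z)$ at $z$. $\pi_\psi$ is orthogonal projection onto $\psi$, $\psi^\perp$ the orthogonal complement, $\Gamma(\cdot)$ the smooth sections. For mutually orthogonal subbundles $\psi,\chi$, the second fundamental form is $A'_{\psi,\chi}=\pi_\chi\circ\partial_z|_\psi:\psi\to\chi$ (a bundle map); $A'_\psi=A'_{\psi,\psi^\perp}$. Images and kernels of bundle maps are understood as extended to subbundles over the isolated points where the rank drops (''filling out zeros''); ''rank'' means the maximal (generic) rank. For $\varphi$ harmonic, $G'(\varphi)=\operatorname{Im}A'_\varphi$, $G^{(0)}(\varphi)=\varphi$, $G^{(i+1)}(\varphi)=G'(G^{(i)}(\varphi))$.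 The isotropy order of $\varphi$ is the greatest $r\in\{1,2,\ldots,\infty\}$ such that $\varphi\perp G^{(i)}(\varphi)$ for all $1\le i\le r$; then $G^{(i)}(\varphi)\perp G^{(j)}(\varphi)$ whenever $1\le|i-j|\le r$. For $\varphi$ of finite isotropy order $r$, put $R=\bigl(\sum_{i=0}^rG^{(i)}(\varphi)\bigr)^\perp$. The first return map is the bundle map $\varphi\to\varphi$ $$\mathbf{c}=A'_{G^{(r)}(\varphi),\varphi}\circ A'_{G^{(r-1)}(\varphi)}\circ\cdots\circ A'_{G^{(1)}(\varphi)}\circ A'_\varphi,$$ and the second return map is the bundle map $\varphi\to\varphi$ $$\mathbf{e}=A'_{R,\varphi}\circ A'_{G^{(r)}(\varphi),R}\circ A'_{G^{(r-1)}(\varphi)}\circ\cdots\circ A'_{G^{(1)}(\varphi)}\circ A'_\varphi .$$ These are defined on each coordinate chart; a change of coordinate multiplies them by nowhere-zero functions. The nilorder of $\mathbf{c}$ is the least $p$ with $\mathbf{c}^p=0$. Finite uniton number: for smooth $\varphi:M\to U(n)$ put $A^\varphi_z=\frac12\varphi^{-1}\partial_z\varphi$, $A^\varphi_{\bar z}=\frac12\varphi^{-1}\partial_{\bar z}\varphi$. A uniton for a harmonic $\varphi:M\to U(n)$ is a subbundle $\alpha$ of $M\times\mathbb{C}^n$ with $\Gamma(\alpha)$ closed under $\partial_{\bar z}+A^\varphi_{\bar z}$ and under $A^\varphi_z$. $\varphi$ is of finite uniton number if $\varphi=\varphi_0(\pi_{\alpha_1}-\pi_{\alpha_1}^\perp)\cdots(\pi_{\alpha_s}-\pi_{\alpha_s}^\perp)$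 for some $s\ge0$, with $\varphi_0\in U(n)$ constant and each $\alpha_i$ a uniton for the partial product of the first $i-1$ factors (times $\varphi_0$). A map $\varphi:M\to G_k(\mathbb{C}^n)$ is of finite uniton number if $\pi_\varphi-\pi_\varphi^\perp:M\to U(n)$ is. *)

(* Defs.v *)
From HB Require Import structures.
From mathcomp Require Import all_boot all_order all_algebra complex.
From mathcomp Require Import all_classical all_reals all_analysis ring.

Set Implicit Arguments.
Unset Strict Implicit.
Unset Printing Implicit Defensive.

Import Order.TTheory GRing.Theory Num.Theory.
Import numFieldNormedType.Exports.
Local Open Scope classical_set_scope.
Local Open Scope sesquilinear_scope.
Local Open Scope complex_scope.
Local Open Scope ring_scope.

(* The domain C of a local coordinate z = x + iy is R * R, with its product
   topology; values are in R[i]. *)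
Section Plane.
Variable R : realType.

Fixpoint Ck (k : nat) (U : set (R * R)) (f : R * R -> R) : Prop :=
  (forall x, U x -> {for x, continuous f}) /\
  match k with
  | 0 => True
  | k'.+1 =>
    [/\ forall x, U x -> derivable f x (1, 0) /\ derivable f x (0, 1),
        Ck k' U ('D_(1, 0) f)
      & Ck k' U ('D_(0, 1) f)]
  end.

Definition Cinfty (U : set (R * R)) (f : R * R -> R[i]) : Prop :=
  forall k, Ck k U (fun x => complex.Re (f x)) /\
            Ck k U (fun x => complex.Im (f x)).

Definition partial (v : R * R) (f : R * R -> R[i]) (x : R * R) : R[i] :=
  'D_v (fun y => complex.Re (f y)) x +i* 'D_v (fun y => complex.Im (f y)) x.

Definition wirtinger (f : R * R -> R[i]) (x : R * R) : R[i] :=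
  2^-1 * (partial (1, 0) f x - 'i%C * partial (0, 1) f x).

Definition wirtinger_bar (f : R * R -> R[i]) (x : R * R) : R[i] :=
  2^-1 * (partial (1, 0) f x + 'i%C * partial (0, 1) f x).

Definition holomorphic_on (U : set (R * R)) (f : R * R -> R[i]) : Prop :=
  Cinfty U f /\ forall x, U x -> wirtinger_bar f x = 0.

Definition cderivable (v : R * R) (f : R * R -> R[i]) (x : R * R) : Prop :=
  derivable (fun y => complex.Re (f y)) x v /\
  derivable (fun y => complex.Im (f y)) x v.

Lemma partialD v (f g : R * R -> R[i]) x :
  cderivable v f x -> cderivable v g x ->
  cderivable v (fun y => f y + g y) x /\
  partial v (fun y => f y + g y) x = partial v f x + partial v g x.
Proof.
move=> [fr fi] [gr gi].
have Er : (fun y => complex.Re (f y + g y)) =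
   (fun y => complex.Re (f y)) + (fun y => complex.Re (g y)).
  by apply/funext => y; rewrite fctE; case: (f y) (g y) => ? ? [? ?].
have Ei : (fun y => complex.Im (f y + g y)) =
   (fun y => complex.Im (f y)) + (fun y => complex.Im (g y)).
  by apply/funext => y; rewrite fctE; case: (f y) (g y) => ? ? [? ?].
rewrite /cderivable /partial Er Ei; split.
  by split; [exact: derivableD fr gr|exact: derivableD fi gi].
by rewrite (deriveD fr gr) (deriveD fi gi).
Qed.

Lemma partialM v (f g : R * R -> R[i]) x :
  cderivable v f x -> cderivable v g x ->
  cderivable v (fun y => f y * g y) x /\
  partial v (fun y => f y * g y) x = partial v f x * g x + f x * partial v g x.
Proof.
move=> [fr fi] [gr gi].
have Er : (fun y => complex.Re (f y * g y)) =
   (fun y => complex.Re (f y)) * (fun y => complex.Re (g y)) -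
   (fun y => complex.Im (f y)) * (fun y => complex.Im (g y)).
  by apply/funext => y; rewrite !fctE; case: (f y) (g y) => ? ? [? ?].
have Ei : (fun y => complex.Im (f y * g y)) =
   (fun y => complex.Re (f y)) * (fun y => complex.Im (g y)) +
   (fun y => complex.Im (f y)) * (fun y => complex.Re (g y)).
  by apply/funext => y; rewrite !fctE; case: (f y) (g y) => ? ? [? ?].
rewrite /cderivable /partial Er Ei; split.
  split; first exact: derivableB (derivableM fr gr) (derivableM fi gi).
  exact: derivableD (derivableM fr gi) (derivableM fi gr).
rewrite (deriveB (derivableM fr gr) (derivableM fi gi)).
rewrite (deriveD (derivableM fr gi) (derivableM fi gr)).
rewrite (deriveM fr gr) (deriveM fi gi) (deriveM fr gi) (deriveM fi gr).
case: (f x) (g x) => a b [c d] /=; apply/eqP; rewrite eq_complex /= /GRing.scale /=.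
by apply/andP; split; apply/eqP; ring.
Qed.

Lemma partial_sum v n (h : 'I_n -> R * R -> R[i]) x :
  (forall i, cderivable v (h i) x) ->
  cderivable v (fun y => \sum_i h i y) x /\
  partial v (fun y => \sum_i h i y) x = \sum_i partial v (h i) x.
Proof.
elim: n h => [|n IH] h hd.
  have -> : (fun y => \sum_i h i y) = (fun=> 0) by apply/funext=> y; rewrite big_ord0.
  rewrite big_ord0 /partial /cderivable; split; first by split; exact: derivable_cst.
  by rewrite /= !derive_cst.
have -> : (fun y => \sum_i h i y) =
  (fun y => h ord0 y + \sum_i h (lift ord0 i) y).
  by apply/funext=> y; rewrite big_ord_recl.
have [d e] := IH _ (fun i => hd (lift ord0 i)).
have [d' e'] := partialD (hd ord0) d.
by split=> //; rewrite e' e big_ord_recl.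
Qed.

Lemma near_partial v (f g : R * R -> R[i]) x : v != 0 ->
  (\forall y \near x, f y = g y) -> partial v f x = partial v g x.
Proof.
move=> v0 fg; rewrite /partial.
by congr (_ +i* _); apply: near_eq_derive => //; apply: filterS fg => y ->.
Qed.

Lemma Cinfty_derivable U (f : R * R -> R[i]) x : Cinfty U f -> U x ->
  cderivable (1, 0) f x /\ cderivable (0, 1) f x.
Proof.
move=> /(_ 1) [[_ [fr _ _]] [_ [fi _ _]]] Ux.
have [r1 r2] := fr x Ux; have [i1 i2] := fi x Ux.
exact: (conj (conj r1 i1) (conj r2 i2)).
Qed.
End Plane.

Record chart (R : realType) (M : topologicalType) := Chart {
  cdom : set M;
  zcoord : M -> R * R;
  cinv : R * R -> M;
  cdom_open : open cdom;
  crange_open : open (zcoord @` cdom);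
  zcoordK : forall p, cdom p -> cinv (zcoord p) = p;
  zcoord_continuous : forall p, cdom p -> {for p, continuous zcoord};
  cinv_continuous :
    forall x, (zcoord @` cdom) x -> {for x, continuous cinv}
}.

Record riemann_surface (R : realType) := RiemannSurface {
  carrier :> topologicalType;
  atlas : set (chart R carrier);
  surface_hausdorff : hausdorff_space carrier;
  surface_connected : connected [set: carrier];
  atlas_cover : forall p : carrier, exists2 u, atlas u & cdom u p;
  atlas_compatible : forall u v, atlas u -> atlas v ->
    holomorphic_on (zcoord u @` (cdom u `&` cdom v))
      (fun x => let y := zcoord v (cinv u x) in y.1 +i* y.2)
}.

Section Maps.
Variables (R : realType) (M : riemann_surface R).
Local Notation C := R[i].
Local Notation chartM := (chart R M).

Definition smooth_on (V : set M) (m n : nat) (f : M -> 'M[C]_(m, n)) : Prop :=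
  forall u : chartM, atlas u -> forall i j,
    Cinfty (zcoord u @` (cdom u `&` V)) (fun x => f (cinv u x) i j).

(* Flat derivatives with respect to the coordinate z of the chart u; they are
   meaningful at the points of cdom u only. *)
Definition dz (u : chartM) (m n : nat) (f : M -> 'M[C]_(m, n)) (p : M)
    : 'M[C]_(m, n) :=
  \matrix_(i, j) wirtinger (fun x => f (cinv u x) i j) (zcoord u p).

Definition dzbar (u : chartM) (m n : nat) (f : M -> 'M[C]_(m, n)) (p : M)
    : 'M[C]_(m, n) :=
  \matrix_(i, j) wirtinger_bar (fun x => f (cinv u x) i j) (zcoord u p).

Variable n : nat.

(* A subspace of C^n (column vectors) is given by the orthogonal projection
   onto it, so that a map psi into a Grassmannian, or a subbundle psi of
   M x C^n, is the projection-valued function pi_psi. The rank of a subbundle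
   is constant because M is connected. *)
Definition orthoproj (P : 'M[C]_n) : Prop := P ^t* = P /\ P *m P = P.

Definition subbundle (psi : M -> 'M[C]_n) : Prop :=
  smooth_on setT psi /\ forall p, orthoproj (psi p).

Definition grassmannian_map (k : nat) (phi : M -> 'M[C]_n) : Prop :=
  subbundle phi /\ forall p, \rank (phi p) = k.

Definition perp (psi : M -> 'M[C]_n) : M -> 'M[C]_n :=
  fun p => 1%:M - psi p.

Definition orthogonal_bundles (psi chi : M -> 'M[C]_n) : Prop :=
  forall p, psi p *m chi p = 0.

Definition in_fibre (psi : M -> 'M[C]_n) (p : M) (v : 'cV[C]_n) : Prop :=
  psi p *m v = v.

(* A bundle map is a family of matrices, one for each chart u and each point
   of cdom u, extended by zero on the orthogonal complement of its source;
   composition is matrix multiplication. *)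
Definition bundle_map := chartM -> M -> 'M[C]_n.

Definition bmul (B1 B2 : bundle_map) : bundle_map :=
  fun u p => B1 u p *m B2 u p.

Definition bzero (B : bundle_map) : Prop :=
  forall u p, atlas u -> cdom u p -> B u p = 0.

Definition brestrict (B : bundle_map) (alpha : M -> 'M[C]_n) : bundle_map :=
  fun u p => B u p *m alpha p.

(* j-th power of an endomorphism B of the bundle alpha; the 0-th power is the
   identity of alpha. *)
Definition bpow (alpha : M -> 'M[C]_n) (B : bundle_map) (j : nat)
    : bundle_map :=
  fun u p => iter j (mulmx (B u p)) (alpha p).

Definition bnilpotent (alpha : M -> 'M[C]_n) (B : bundle_map) : Prop :=
  exists j, bzero (bpow alpha B j).

Definition nilorder (alpha : M -> 'M[C]_n) (B : bundle_map) (j : nat) : Prop :=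
  bzero (bpow alpha B j) /\ forall i, (i < j)%N -> ~ bzero (bpow alpha B i).

(* The rank of a bundle map is the maximum of its pointwise ranks. *)
Definition brank (B : bundle_map) (r : nat) : Prop :=
  (forall u p, atlas u -> cdom u p -> (\rank (B u p) <= r)%N) /\
  (exists u p, [/\ atlas u, cdom u p & \rank (B u p) = r]).

(* psi is the image of B, filled out at isolated points: it is a subbundle
   whose fibre is the column space of B at all points of some punctured
   neighbourhood of each p in M. By continuity there is at most one such
   psi. *)
Definition is_image (B : bundle_map) (psi : M -> 'M[C]_n) : Prop :=
  subbundle psi /\
  forall p : M, \forall q \near p^', forall u, atlas u -> cdom u q ->
    ((psi q)^T == (B u q)^T)%MS.

(* The second fundamental form A'_{psi,chi}: a vector v in the fibre of psi at
   p is extended to the section q |-> psi q v of psi, which is differentiated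
   and projected to chi. *)
Definition A' (psi chi : M -> 'M[C]_n) : bundle_map :=
  fun u p => chi p *m dz u psi p *m psi p.

Lemma A'_section (u : chartM) (psi chi : M -> 'M[C]_n)
    (s : M -> 'cV[C]_n) (p : M) :
  atlas u -> cdom u p -> subbundle psi -> orthogonal_bundles chi psi ->
  smooth_on (cdom u) s -> (forall q, cdom u q -> in_fibre psi q (s q)) ->
  A' psi chi u p *m s p = chi p *m dz u s p.
Proof.
move=> au up [psi_smooth _] ort s_smooth s_psi.
set x := zcoord u p; have Ux : (zcoord u @` cdom u) x by exists p.
have psid i j : cderivable (1, 0) (fun y => psi (cinv u y) i j) x /\
                cderivable (0, 1) (fun y => psi (cinv u y) i j) x.
  by apply: (Cinfty_derivable (psi_smooth u au i j)); rewrite setIT.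
have sd i j : cderivable (1, 0) (fun y => s (cinv u y) i j) x /\
              cderivable (0, 1) (fun y => s (cinv u y) i j) x.
  by apply: (Cinfty_derivable (s_smooth u au i j)); rewrite setIid.
have prod v i : v != 0 ->
    (forall a b, cderivable v (fun y => psi (cinv u y) a b) x) ->
    (forall a b, cderivable v (fun y => s (cinv u y) a b) x) ->
    partial v (fun y => s (cinv u y) i 0) x =
    \sum_j (partial v (fun y => psi (cinv u y) i j) x * s p j 0
           + psi p i j * partial v (fun y => s (cinv u y) j 0) x).
  move=> v0 dpsi ds.
  rewrite (@near_partial _ v _
    (fun y => \sum_j psi (cinv u y) i j * s (cinv u y) j 0)) //; last first.
    have : nbhs x (zcoord u @` cdom u) by apply: open_nbhs_nbhs; split; [exact: crange_open|].
    apply: filterS => y [q uq <-]; rewrite zcoordK //.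
    by rewrite -{1}(s_psi q uq) mxE.
  have [_ ->] := partial_sum (v := v) (x := x)
    (fun j => (partialM (dpsi i j) (ds j 0)).1).
  by apply: eq_bigr => j _; rewrite (partialM (dpsi i j) (ds j 0)).2 zcoordK.
have n1 : ((1, 0) : R * R) != 0 by rewrite xpair_eqE oner_eq0.
have n2 : ((0, 1) : R * R) != 0 by rewrite xpair_eqE oner_eq0 andbF.
have dzs : dz u s p = dz u psi p *m s p + psi p *m dz u s p.
  apply/matrixP => i j; rewrite !mxE ord1 {j} /wirtinger.
  rewrite (prod _ _ n1); [|by move=> a b; have [] := psid a b
                          |by move=> a b; have [] := sd a b].
  rewrite (prod _ _ n2); [|by move=> a b; have [] := psid a b
                          |by move=> a b; have [] := sd a b].
  rewrite mulr_sumr -sumrB mulr_sumr -big_split /=; apply: eq_bigr => j _.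
  rewrite !mxE /wirtinger -/x.
  move: (partial _ _ _) (partial _ _ _) (partial _ _ _) (partial _ _ _) => a b c d.
  by ring.
rewrite dzs mulmxDr mulmxA (mulmxA _ (psi p)) ort mul0mx addr0.
by rewrite /A' -!mulmxA (s_psi p up) mulmxA.
Qed.

Definition A'perp (psi : M -> 'M[C]_n) : bundle_map := A' psi (perp psi).

Definition Az (u : chartM) (Phi : M -> 'M[C]_n) (p : M) : 'M[C]_n :=
  2^-1 *: (invmx (Phi p) *m dz u Phi p).

Definition Azbar (u : chartM) (Phi : M -> 'M[C]_n) (p : M) : 'M[C]_n :=
  2^-1 *: (invmx (Phi p) *m dzbar u Phi p).

(* Smooth maps M -> U(n) satisfying the harmonic map equation
   d^*(Phi^-1 dPhi) = 0. *)
Definition harmonicU (Phi : M -> 'M[C]_n) : Prop :=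
  [/\ smooth_on setT Phi,
      forall p, Phi p \is unitarymx
    & forall u p, atlas u -> cdom u p ->
        dzbar u (Az u Phi) p + dz u (Azbar u Phi) p = 0].

(* The Cartan embedding of the Grassmannians in U(n). It is totally geodesic,
   so that a map into a Grassmannian is harmonic iff its composition with this
   embedding is. *)
Definition cartan (phi : M -> 'M[C]_n) : M -> 'M[C]_n :=
  fun p => phi p - perp phi p.

Definition harmonic_map (phi : M -> 'M[C]_n) : Prop := harmonicU (cartan phi).

Definition uniton (Phi alpha : M -> 'M[C]_n) : Prop :=
  [/\ harmonicU Phi, subbundle alpha
    & forall (u : chartM) (s : M -> 'cV[C]_n), atlas u ->
        smooth_on (cdom u) s ->
        (forall p, cdom u p -> in_fibre alpha p (s p)) ->
        forall p, cdom u p ->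
          in_fibre alpha p (dzbar u s p + Azbar u Phi p *m s p) /\
          in_fibre alpha p (Az u Phi p *m s p)].

Fixpoint uniton_product (phi0 : 'M[C]_n) (alpha : nat -> M -> 'M[C]_n)
    (s : nat) : M -> 'M[C]_n :=
  match s with
  | 0 => fun=> phi0
  | s'.+1 => fun p => uniton_product phi0 alpha s' p *m cartan (alpha s') p
  end.

Definition finite_uniton_numberU (Phi : M -> 'M[C]_n) : Prop :=
  exists (s : nat) (phi0 : 'M[C]_n) (alpha : nat -> M -> 'M[C]_n),
    [/\ phi0 \is unitarymx,
        forall i, (i < s)%N -> uniton (uniton_product phi0 alpha i) (alpha i)
      & forall p, Phi p = uniton_product phi0 alpha s p].

Definition finite_uniton_number (phi : M -> 'M[C]_n) : Prop :=
  finite_uniton_numberU (cartan phi).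

(* G i is the i-th Gauss bundle G^(i)(phi). *)
Definition gauss_bundles (phi : M -> 'M[C]_n) (G : nat -> M -> 'M[C]_n)
    : Prop :=
  G 0 = phi /\ forall i, is_image (A'perp (G i)) (G i.+1).

Definition isotropy_order (G : nat -> M -> 'M[C]_n) (r : nat) : Prop :=
  [/\ (1 <= r)%N,
      forall i, (1 <= i <= r)%N -> orthogonal_bundles (G 0) (G i)
    & ~ orthogonal_bundles (G 0) (G r.+1)].

(* The orthogonal complement of G 0 + ... + G r; these bundles are mutually
   orthogonal when r is the isotropy order, so that the projection onto their
   sum is the sum of the projections. *)
Definition remainder (G : nat -> M -> 'M[C]_n) (r : nat) : M -> 'M[C]_n :=
  fun p => 1%:M - \sum_(i < r.+1) G i p.

Lemma in_fibre_remainder (G : nat -> M -> 'M[C]_n) (r : nat) (p : M)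
    (v : 'cV[C]_n) :
  (forall i, orthoproj (G i p)) ->
  in_fibre (remainder G r) p v <->
  forall i, (i <= r)%N -> G i p *m v = 0.
Proof.
move=> projG; rewrite /in_fibre /remainder mulmxBl mul1mx mulmx_suml.
split=> [/eqP|Gv0]; last first.
  by rewrite big1 ?subr0// => i _; rewrite Gv0// -ltnS.
rewrite subr_eq addrC -subr_eq subrr => /eqP/esym E.
have sq i : (v^t* *m (G i p *m v)) 0 0 = \sum_j `|(G i p *m v) j 0| ^+ 2.
  have [h2 h1] := projG i.
  have -> : v^t* *m (G i p *m v) = (G i p *m v)^t* *m (G i p *m v).
    rewrite trmx_mul map_mxM -mulmxA; congr (_ *m _).
    apply/esym; rewrite mulmxA; congr (_ *m _).
    by rewrite -[RHS]h1; congr (_ *m _); exact: h2.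
  by rewrite !mxE; apply: eq_bigr => j _; rewrite !mxE mulrC -normCK.
have /eqP : \sum_(i < r.+1) (v^t* *m (G i p *m v)) 0 0 = 0.
  by rewrite -summxE -mulmx_sumr E mulmx0 mxE.
rewrite psumr_eq0 => [/allP H i ir|i _]; last first.
  by rewrite sq sumr_ge0 // => j _; rewrite exprn_ge0.
have := H (Ordinal (ir : (i < r.+1)%N)) (mem_index_enum _).
rewrite /= sq psumr_eq0 => [/allP K|j _]; last by rewrite exprn_ge0.
apply/matrixP => j k; rewrite ord1 [RHS]mxE.
by have /= := K j (mem_index_enum _); rewrite sqrf_eq0 normr_eq0 => /eqP.
Qed.
(* A'_(G (j-1)) o ... o A'_(G 0) *)
Fixpoint gauss_chain (G : nat -> M -> 'M[C]_n) (j : nat) : bundle_map :=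
  match j with
  | 0 => fun u p => G 0 p
  | j'.+1 => bmul (A'perp (G j')) (gauss_chain G j')
  end.

Definition first_return (G : nat -> M -> 'M[C]_n) (r : nat) : bundle_map :=
  bmul (A' (G r) (G 0)) (gauss_chain G r).

Definition second_return (G : nat -> M -> 'M[C]_n) (r : nat) : bundle_map :=
  let Rb := remainder G r in
  bmul (A' Rb (G 0)) (bmul (A' (G r) Rb) (gauss_chain G r)).

End Maps.

(* Main.v *)
Require Import Defs.
From HB Require Import structures.
From mathcomp Require Import all_boot all_order all_algebra complex.
From mathcomp Require Import all_classical all_reals all_analysis.
From mathcomp Require Import zify ssrAC ring.

(* Write d for the derivative along z, a = A_z and mu for the inverse spectral
   parameter. Adding a uniton alpha conjugates the pencil d + a - mu a by
   pi_alpha + mu pi_alpha^perp, so for a map obtained from s unitons the powers of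
   the pencil have degree at most s in mu. For phi Grassmannian, split such a power
   according to the successive returns of a path to phi: the fastest return, in
   r + 1 steps, is c, and the next one, in r + 2 steps, is e plus a term which c
   annihilates because c^2 = 0. Each return costs mu^2. The top-degree coefficients
   are therefore computed by counting steps: since c c = 0 the only surviving words
   are (c e)^m c, whence (c e)^m c = 0 and, as c has rank 2, c e c e c = 0 and
   rank (c e c) <= 1; using this, with start c e c the only surviving words are
   (c e c e e)^m c e c. So c e c e e is nilpotent on the image eta of c e c,
   hence zero on it because eta has rank at most 1. *)

Set Implicit Arguments.
Unset Strict Implicit.
Unset Printing Implicit Defensive.

Import Order.TTheory GRing.Theory Num.Theory.
Import numFieldNormedType.Exports.
Local Open Scope classical_set_scope.
Local Open Scope sesquilinear_scope.
Local Open Scope complex_scope.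
Local Open Scope ring_scope.

(** * Words in the return maps *)

(* [u rho x] stands for the sum of all words applied to [s] in letters D, E_0,
   E_1, E_2, ... with [rho] letters E_y (the returns) and total excess [x], where
   D has excess 1 and E_y has excess y; E_0 is multiplication by [c] and E_1 is
   [E]. [u_rec] splits off the first letter; its premise says that the letters
   E_y with y >= 2 contribute nothing. *)
Section ReturnWords.
Variables (V : pzRingType) (D E : V -> V) (c e s : V) (r : nat).
Variable u : int -> int -> V.
Hypothesis D0 : D 0 = 0.
Hypothesis E0 : E 0 = 0.
Hypothesis u_neg : forall rho x : int, x + r.+1%:Z * rho < 0 -> u rho x = 0.
Hypothesis u_start : u 0 0 = s.
Hypothesis u_rec : forall rho x : int, (rho, x) != (0, 0) ->
  (forall y : int, y < x - 1 -> u (rho - 1) y = 0) ->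
  u rho x = D (u rho (x - 1)) + c * u (rho - 1) x + E (u (rho - 1) (x - 1)).
Hypothesis cc : c * c = 0.
Hypothesis cE : forall v, c * E v = c * e * v.

(** The quantity [x + r.+1 * rho] is the length of the underlying paths. Every letter increases it,
    so strong induction on it fits the recursion [u_rec]; negative lengths are left to [u_neg]. *)
Let u_ind (P : int -> int -> Prop) :
  (forall rho x : int, (forall rho' x' : int, x' + r.+1%:Z * rho' < x + r.+1%:Z * rho ->
     0 <= x' + r.+1%:Z * rho' -> P rho' x') -> P rho x) ->
  forall rho x : int, P rho x.
Proof.
move=> IH rho x; apply: (IH) => rho' x' _ ge0.
have [n] := ubnP `|(x' + r.+1%:Z * rho')%R|%N; elim: n => // n IHn in rho' x' ge0 *.
move=> lt_n; apply: (IH) => rho2 x2 lt2 ge2; apply: IHn => //; lia.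
Qed.

(* The weight 2x - rho is 2 for D, -1 for c and at least 1 for the other returns.
   As c c = 0, two letters of negative weight are never adjacent. *)
Lemma words_vanish (cs : c * s = 0) rho x :
  (2 * x - rho < 0 -> u rho x = 0) /\ (2 * x - rho < 1 -> c * u rho x = 0).
Proof.
move: rho x; apply: u_ind => rho x IH.
have IHa (rho' x' : int) : x' + r.+1%:Z * rho' < x + r.+1%:Z * rho ->
    2 * x' - rho' < 0 -> u rho' x' = 0.
  move=> lt w; case: (ltP (x' + r.+1%:Z * rho') 0) => [/u_neg//|ge0].
  by have [+ _] := IH _ _ lt ge0; apply.
have IHb (rho' x' : int) : x' + r.+1%:Z * rho' < x + r.+1%:Z * rho ->
    2 * x' - rho' < 1 -> c * u rho' x' = 0.
  move=> lt w; case: (ltP (x' + r.+1%:Z * rho') 0) => [/u_neg->|ge0].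
    by rewrite mulr0.
  by have [_ +] := IH _ _ lt ge0; apply.
have [[-> ->]|nz] := eqVneq (rho, x) (0, 0).
  by split=> [//|_]; rewrite u_start.
(* The premise of [u_rec] holds since removing a letter E_y with y >= 2 leaves a word of negative
   weight. *)
split=> w; (rewrite u_rec //; last by move=> y lty; apply: IHa; nia).
  rewrite IHa ?D0; [|lia|lia].
  rewrite IHb; [|nia|lia].
  by rewrite IHa ?E0 ?addr0 //; nia.
rewrite !mulrDr mulrA cc mul0r.
rewrite IHa ?D0 ?mulr0; [|lia|lia].
by rewrite cE [u (rho - 1) _]IHa ?mulr0 ?addr0 //; nia.
Qed.

(** These words have weight 0. A first letter D or E leaves negative weight, so the first letter is
    [c], leaving weight 1. After it D leaves negative weight and [c] dies by [c * c = 0]; only E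
    remains, which brings the weight back to 0. *)
Lemma words_alternating (cs : c * s = 0) (m : nat) :
  u m.*2%:Z m%:Z = (c * e) ^+ m * s.
Proof.
have za rho x : 2 * x - rho < 0 -> u rho x = 0 by apply: (words_vanish cs _ _).1.
elim: m => [|m IH]; first by rewrite u_start mul1r.
rewrite u_rec; [|by []|by move=> y lty; apply: za; lia].
rewrite za ?D0 ?add0r; last by lia.
rewrite [X in E X]za ?E0 ?addr0; last by lia.
rewrite u_rec; [|by rewrite xpair_eqE; lia|by move=> y lty; apply: za; lia].
rewrite za ?D0 ?add0r; last by lia.
rewrite mulrDr mulrA cc mul0r add0r cE.
by rewrite exprS -[RHS]mulrA -IH; congr (_ * u _ _); lia.
Qed.

Hypothesis cec : c * e * c * e * c = 0.
Hypothesis cecE : forall v, c * e * c * e * E v = c * e * c * e * e * v.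
Hypothesis cs : c * s = 0.
Hypothesis ces : c * e * s = 0.

(* The weight 5x - 3rho is 5 for D, -3 for c, 2 for E and at least 7 for the other
   returns. A block consisting of c and the letters up to the next c has negative
   weight only if it is c E, and two blocks c E followed by c vanish, so the
   words of minimal weight are those repeating c E c E E. *)
Lemma words_vanish2 rho x :
  [/\ 5 * x - 3 * rho < 0 -> u rho x = 0,
      5 * x - 3 * rho < 3 -> c * u rho x = 0
    & 5 * x - 3 * rho < 4 -> c * e * c * u rho x = 0].
Proof.
move: rho x; apply: u_ind => rho x IH.
have IHa (rho' x' : int) : x' + r.+1%:Z * rho' < x + r.+1%:Z * rho ->
    5 * x' - 3 * rho' < 0 -> u rho' x' = 0.
  move=> lt w; case: (ltP (x' + r.+1%:Z * rho') 0) => [/u_neg//|ge0].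
  by have [+ _ _] := IH _ _ lt ge0; apply.
have IHb (rho' x' : int) : x' + r.+1%:Z * rho' < x + r.+1%:Z * rho ->
    5 * x' - 3 * rho' < 3 -> c * u rho' x' = 0.
  move=> lt w; case: (ltP (x' + r.+1%:Z * rho') 0) => [/u_neg->|ge0].
    by rewrite mulr0.
  by have [_ + _] := IH _ _ lt ge0; apply.
have IHc (rho' x' : int) : x' + r.+1%:Z * rho' < x + r.+1%:Z * rho ->
    5 * x' - 3 * rho' < 4 -> c * e * c * u rho' x' = 0.
  move=> lt w; case: (ltP (x' + r.+1%:Z * rho') 0) => [/u_neg->|ge0].
    by rewrite mulr0.
  by have [_ _ +] := IH _ _ lt ge0; apply.
(* In weight below 2, removing D or E leaves negative weight, so a nonempty word must begin with
   [c]. *)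
have low (rho' x' : int) : x' + r.+1%:Z * rho' < x + r.+1%:Z * rho ->
    5 * x' - 3 * rho' < 2 ->
    u rho' x' = c * u (rho' - 1) x' \/ (rho', x') = (0, 0).
  move=> lt w; have [|nz] := eqVneq (rho', x') (0, 0); [by right|left].
  rewrite u_rec //; last by move=> y lty; apply: IHa; nia.
  rewrite IHa ?D0 ?add0r; [|lia|lia].
  by rewrite [u _ (x' - 1)]IHa ?E0 ?addr0 //; nia.
have [[-> ->]|nz] := eqVneq (rho, x) (0, 0).
  by split=> [//|_|_]; rewrite u_start // -mulrA cs mulr0.
have cel (rho' x' : int) : x' + r.+1%:Z * rho' < x + r.+1%:Z * rho ->
    5 * x' - 3 * rho' < 1 -> c * e * u rho' x' = 0.
  move=> lt w; case: (low _ _ lt) => [|->|[-> ->]]; [lia| |by rewrite u_start].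
  by rewrite mulrA IHc //; nia.
have cecel (rho' x' : int) : x' + r.+1%:Z * rho' < x + r.+1%:Z * rho ->
    5 * x' - 3 * rho' < 2 -> c * e * c * e * u rho' x' = 0.
  move=> lt w; case: (low _ _ lt) => [|->|[-> ->]]; [lia| |].
    by rewrite mulrA cec mul0r.
  by rewrite u_start -[c * e * c * e]mulrA -mulrA ces mulr0.
split=> w; (rewrite u_rec //; last by move=> y lty; apply: IHa; nia).
- rewrite IHa ?D0; [|lia|lia].
  rewrite IHb; [|nia|lia].
  by rewrite IHa ?E0 ?addr0 //; nia.
- rewrite !mulrDr mulrA cc mul0r.
  rewrite IHa ?D0 ?mulr0; [|lia|lia].
  by rewrite cE cel ?addr0 //; nia.
- rewrite !mulrDr [c * e * c * (c * _)]mulrA -[c * e * c * c]mulrA cc mulr0 mul0r.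
  rewrite IHa ?D0 ?mulr0; [|lia|lia].
  rewrite -[c * e * c]mulrA -mulrA -mulrA cE.
  by rewrite !mulrA cecel ?addr0 //; nia.
Qed.

(** A block c E c E E has five returns and excess three, hence weight 0. Reading it off letter by
    letter leaves the weights 3, 1, 4, 2, 0; each alternative letter leaves negative weight or is
    killed by [cc] or [cec]. *)
Lemma words_alternating2 (m : nat) :
  u (5 * m)%N%:Z (3 * m)%N%:Z = (c * e * c * e * e) ^+ m * s.
Proof.
have za rho x : 5 * x - 3 * rho < 0 -> u rho x = 0.
  by have [+ _ _] := words_vanish2 rho x; apply.
have low rho x : (rho, x) != (0, 0) -> 5 * x - 3 * rho < 2 ->
    u rho x = c * u (rho - 1) x.
  move=> nz w; rewrite u_rec //; last by move=> y lty; apply: za; lia.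
  rewrite za ?D0 ?add0r; [|lia].
  by rewrite [u _ (x - 1)]za ?E0 ?addr0 //; lia.
elim: m => [|m IH]; first by rewrite u_start mul1r.
rewrite low; [|by rewrite xpair_eqE; lia|lia].
rewrite u_rec; [|by rewrite xpair_eqE; lia|by move=> y lty; apply: za; lia].
rewrite za ?D0 ?add0r; last by lia.
rewrite mulrDr mulrA cc mul0r add0r cE.
rewrite low; [|by rewrite xpair_eqE; lia|lia].
rewrite u_rec; [|by rewrite xpair_eqE; lia|by move=> y lty; apply: za; lia].
rewrite za ?D0 ?add0r; last by lia.
rewrite mulrA mulrDr [_ * (c * _)]mulrA -[c * e * c * c]mulrA cc mulr0 mul0r add0r.
rewrite -[c * e * c]mulrA -mulrA -mulrA cE mulrA mulrA.
rewrite u_rec; [|by rewrite xpair_eqE; lia|by move=> y lty; apply: za; lia].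
rewrite za ?D0 ?add0r; last by lia.
rewrite mulrDr !mulrA cec mul0r add0r cecE.
by rewrite exprS -[RHS]mulrA -IH; congr (_ * u _ _); lia.
Qed.
End ReturnWords.

(** * Pencils and returns in a ring with derivation *)

Section Derivation.
Variables (V : pzRingType) (d : V -> V).
Hypothesis dD : forall x y, d (x + y) = d x + d y.
Hypothesis dM : forall x y, d (x * y) = d x * y + x * d y.

Lemma der0 : d 0 = 0.
Proof. by apply: (addrI (d 0)); rewrite -dD !addr0. Qed.
Lemma derN x : d (- x) = - d x.
Proof. by apply/eqP; rewrite -addr_eq0 -dD addNr der0. Qed.
Lemma derB x y : d (x - y) = d x - d y.
Proof. by rewrite dD derN. Qed.
Lemma der1 : d 1 = 0.
Proof. by apply: (addrI (d 1)); rewrite addr0 -{3}[1]mul1r dM mulr1 mul1r. Qed.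
Lemma derC al : d (1 - al) = - d al.
Proof. by rewrite derB der1 sub0r. Qed.
Lemma der_sum (I : Type) (s : seq I) (P : pred I) F :
  d (\sum_(i <- s | P i) F i) = \sum_(i <- s | P i) d (F i).
Proof. by apply: (big_morph d dD der0). Qed.

(* With mu the inverse spectral parameter and f = \sum_j f_j mu^j, [pencil a]
   is the operator d + a - mu a, and [flip al] multiplication by
   al + mu (1 - al). *)
Definition pencil (a : V) (f : int -> V) (j : int) : V :=
  d (f j) + a * f j - a * f (j - 1).

Definition flip (al : V) (f : int -> V) (j : int) : V :=
  al * f j + (1 - al) * f (j - 1).

Definition pencil_bounded (a : V) (m : int) : Prop :=
  forall N f, (forall j : int, 0 < j -> f j = 0) ->
  forall j : int, m < j -> iter N (pencil a) f j = 0.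

Lemma pencil_bounded0 : pencil_bounded 0 0.
Proof.
move=> N f f0; elim: N => [|N IH] j j0 /=; first exact: f0.
by rewrite /pencil IH // der0 !mul0r addr0 subr0.
Qed.

Lemma eq_pencil a f g : f =1 g -> pencil a f =1 pencil a g.
Proof. by move=> fg j; rewrite /pencil !fg. Qed.

Lemma eq_iter_pencil a N f g :
  f =1 g -> iter N (pencil a) f =1 iter N (pencil a) g.
Proof. by move=> fg; elim: N => //= N IH; exact: eq_pencil. Qed.

(** If [a] is half the logarithmic derivative of P, this is half that of P times the reflection
    [2 * al - 1]. *)
Definition adding_uniton (a al : V) : V :=
  (2 * al - 1) * (a * (2 * al - 1) + d al).

(** * Gauge transformation of the pencil by a uniton *)

Section AddingUniton.
Variables a al : V.
Hypothesis al_idem : al * al = al.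
(** This is closure of the uniton under A_z; [al_D] is the adjoint of its closure under the dbar
    operator, so that only [d] occurs. *)
Hypothesis al_A : (1 - al) * a * al = 0.
Hypothesis al_D : d al * (1 - al) = al * a * (1 - al).

Let sal : (2 * al - 1) * al = al.
Proof. by rewrite mulrBl -mulrA al_idem mul1r mulrDl !mul1r addrK. Qed.
Let sbe : (2 * al - 1) * (1 - al) = - (1 - al).
Proof. by rewrite mulrBr sal mulr1 mulrDl mul1r !opprB addrAC addrK. Qed.
Let alb : al * (1 - al) = 0.
Proof. by rewrite mulrBr mulr1 al_idem subrr. Qed.
Let bal : (1 - al) * al = 0.
Proof. by rewrite mulrBl mul1r al_idem subrr. Qed.
Let dal : d al * al = (1 - al) * d al.
Proof. by rewrite mulrBl mul1r -{1}[in RHS]al_idem dM addrK. Qed.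
Let aal : a * al = al * a * al.
Proof.
by move/eqP: al_A; rewrite mulrBl mul1r mulrBl subr_eq0 => /eqP.
Qed.

Lemma reflectionK : (2 * al - 1) * (2 * al - 1) = 1.
Proof.
have {2}-> : 2 * al - 1 = al - (1 - al).
  by rewrite mulr_natl mulr2n opprB addrA.
by rewrite mulrBr sal sbe opprK addrC subrK.
Qed.

Lemma der_reflection : d (2 * al - 1) = d al + d al.
Proof. by rewrite derB der1 subr0 mulr_natl mulr2n dD. Qed.

Lemma der_mul_reflection P : d P = P * (a + a) ->
  d (P * (2 * al - 1)) =
  P * (2 * al - 1) * (adding_uniton a al + adding_uniton a al).
Proof.
move=> dP; rewrite dM dP der_reflection /adding_uniton.
move: (2 * al - 1) reflectionK => sg sg2.
rewrite -[in RHS]mulrDr -[RHS]mulrA [sg * (sg * _)]mulrA sg2 mul1r.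
by rewrite [in RHS]addrACA -[in RHS]mulrDl [RHS]mulrDr mulrA.
Qed.

Lemma adding_unitonl : adding_uniton a al * al = al * a - d al.
Proof.
have ald : al * d al = al * a - al * a * al.
  have -> : al * d al = d al * (1 - al).
    by rewrite mulrBr mulr1 dal mulrBl mul1r opprB addrCA subrr addr0.
  by rewrite al_D mulrBr mulr1.
rewrite /adding_uniton; move: (2 * al - 1) sal sbe => sg sg_al sg_be.
rewrite -mulrA mulrDl -[a * _ * al]mulrA sg_al dal mulrDr aal.
rewrite !mulrA sg_al sg_be mulNr mulrBl mul1r opprB ald.
by rewrite addrA [X in X - _]addrC subrK.
Qed.

Lemma adding_unitonr : adding_uniton a al * (1 - al) = (1 - al) * a.
Proof.
rewrite /adding_uniton; move: (2 * al - 1) sal sbe => sg sg_al sg_be.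
rewrite -mulrA mulrDl -[a * _ * (1 - al)]mulrA sg_be al_D.
have -> : a * - (1 - al) + al * a * (1 - al) = - (1 - al) * a.
  rewrite mulrN -mulNr -mulrDl addrC -[X in _ - X]mul1r -mulrBl.
  rewrite -opprB !mulNr; congr (- _).
  by rewrite mulrBr mulr1 al_A subr0.
by rewrite mulNr mulrN mulrA sg_be mulNr opprK.
Qed.

(** Compare powers of mu: order 0 is [adding_unitonl], order 2 is [adding_unitonr], and in order 1
    the terms [d al] cancel. *)
Lemma pencil_flip f :
  pencil (adding_uniton a al) (flip al f) =1 flip al (pencil a f).
Proof.
move=> j; rewrite /pencil /flip.
move: (adding_uniton a al) adding_unitonl adding_unitonr => a' a'_al a'_be.
move: (f j) (f (j - 1)) (f (j - 1 - 1)) => x y z.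
have split_a' u v : a' * (al * u + (1 - al) * v) =
    al * a * u - d al * u + (1 - al) * a * v.
  by rewrite mulrDr !mulrA a'_al a'_be (mulrBl u).
rewrite !split_a' dD !dM derC mulNr.
rewrite [in RHS]mulrBr [in RHS]mulrDr !mulrA.
rewrite [X in _ = _ + X]mulrBr [X in _ = _ + (X - _)]mulrDr !mulrA.
rewrite !opprD !opprK !addrA [LHS](ACl (1*6*3*9*2*5*8*4*7*10))/=.
by rewrite subrr add0r addNr add0r.
Qed.

Lemma iter_pencil_flip N f :
  iter N (pencil (adding_uniton a al)) (flip al f) =1
  flip al (iter N (pencil a) f).
Proof.
elim: N => //= N IH j; rewrite -pencil_flip; exact: eq_pencil.
Qed.

Lemma adding_uniton_bounded m :
  pencil_bounded a m -> pencil_bounded (adding_uniton a al) (m + 1).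
Proof.
move=> am N f f0 j mj.
have be : (1 - al) * (1 - al) = 1 - al by rewrite mulrBr mulr1 bal subr0.
(* [g] is [al] plus mu^-1 times [1 - al], applied to [f]: the preimage of [f] under [flip], again
   without positive powers of mu. Applying [flip] at the end raises the degree by at most one. *)
pose g (i : int) := al * f i + (1 - al) * f (i + 1).
have fg : f =1 flip al g.
  move=> i; rewrite /flip /g subrK !mulrDr !mulrA al_idem alb bal be !mul0r.
  by rewrite addr0 add0r -mulrDl addrC subrK mul1r.
rewrite (eq_iter_pencil _ _ fg) iter_pencil_flip /flip.
have g0 (i : int) : 0 < i -> g i = 0.
  by move=> i0; rewrite /g !f0 ?mulr0 ?addr0 //; lia.
by rewrite !am ?mulr0 ?addr0 //; lia.
Qed.
End AddingUniton.

(** * Paths through the Gauss bundles and their returns to [G 0] *)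

Section Returns.
Variables (r : nat) (G : nat -> V).
Hypothesis r_gt0 : (0 < r)%N.
Hypothesis G_idem : forall i, G i * G i = G i.
Hypothesis G0G : forall i, (0 < i <= r)%N -> G 0 * G i = 0.
Hypothesis GG0 : forall i, (0 < i <= r)%N -> G i * G 0 = 0.

Definition fundform (psi chi : V) : V := chi * d psi * psi.
Definition gauss (i : nat) : V := fundform (G i) (1 - G i).
Definition rest : V := 1 - \sum_(i < r.+1) G i.

Fixpoint chain (i : nat) : V :=
  if i is i'.+1 then gauss i' * chain i' else G 0.

Definition closing : V := fundform (G r) (G 0).
Definition return1 : V := closing * chain r.
Definition return2 : V :=
  fundform rest (G 0) * (fundform (G r) rest * chain r).

Hypothesis gauss_sub : forall i, (i < r)%N -> G i.+1 * gauss i = gauss i.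

(** One step of a path that ends outside [G 0]; a return is closed by [G 0 * d _]. *)
Definition away (X : V) : V := (1 - G 0) * d X.

(* [G 0 * d _] kills G i V for 0 < i < r and maps G r V into [closing * V], so
   that the paths away from [G 0] need only be followed modulo these spans. *)
Definition in_span (l : nat) (X : V) : Prop :=
  exists Z : nat -> V, X = \sum_(i < l) G i.+1 * Z i.

Lemma in_span0 l : in_span l 0.
Proof. by exists (fun=> 0); rewrite big1 // => i _; rewrite mulr0. Qed.

Lemma in_spanD l X Y : in_span l X -> in_span l Y -> in_span l (X + Y).
Proof.
move=> [Z ->] [W ->]; exists (fun i => Z i + W i).
by rewrite -big_split; apply: eq_bigr => i _; rewrite mulrDr.
Qed.

Lemma in_spanN l X : in_span l X -> in_span l (- X).
Proof.
move=> [Z ->]; exists (fun i => - Z i).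
by rewrite -sumrN; apply: eq_bigr => i _; rewrite mulrN.
Qed.

Lemma in_span_sum l (I : finType) (F : I -> V) :
  (forall i, in_span l (F i)) -> in_span l (\sum_i F i).
Proof.
move=> FP; elim/big_ind: _ => //; first exact: in_span0.
by move=> x y; exact: in_spanD.
Qed.

Lemma in_spanG l i X : (0 < i <= l)%N -> in_span l (G i * X).
Proof.
case: i => // i /= ltil; exists (fun j => if j == i then X else 0).
rewrite (bigD1 (Ordinal ltil)) //= eqxx big1 ?addr0 // => j.
by rewrite -val_eqE /= => /negbTE ->; rewrite mulr0.
Qed.

Lemma in_span_restG X i : (0 < i <= r)%N -> in_span r (rest * (G i * X)).
Proof.
move=> ir; rewrite mulrBl mul1r; apply: in_spanD; first exact: in_spanG.
apply: in_spanN; rewrite big_ord_recl mulrDl mulrA G0G // mul0r add0r.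
rewrite mulr_suml; apply: in_span_sum => j; apply: in_spanG.
by rewrite lift0 /= ltn_ord.
Qed.

Lemma G0_rest : G 0 * rest = 0.
Proof.
rewrite mulrBr mulr1 big_ord_recl mulrDr G_idem mulr_sumr big1 ?addr0 ?subrr //.
by move=> i _; rewrite G0G // lift0 ltn_ord.
Qed.

Lemma rest_G0 : rest * G 0 = 0.
Proof.
rewrite mulrBl mul1r big_ord_recl mulrDl G_idem mulr_suml big1 ?addr0 ?subrr //.
by move=> i _; rewrite GG0 // lift0 ltn_ord.
Qed.

(** A section of [G i] moves out of [G i] only through its second fundamental form, because P (dP) P
    = 0 for an idempotent P. *)
Lemma der_G i X : d (G i * X) = G i * d (G i * X) + gauss i * X.
Proof.
rewrite -{1}(G_idem i) -[G i * G i * X]mulrA dM /gauss /fundform.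
rewrite !mulrBl mul1r addrC; congr (_ + _).
have -> : G i * d (G i) * G i = 0.
  apply: (addIr (G i * d (G i))); rewrite add0r.
  by rewrite -[in RHS](G_idem i) dM mulrDr !mulrA !G_idem.
by rewrite mul0r subr0 mulrA.
Qed.

Lemma G0_der_G i X : (0 < i < r)%N -> G 0 * d (G i * X) = 0.
Proof.
move=> /andP[i0 ir]; rewrite der_G mulrDr mulrA G0G ?i0 1?ltnW // mul0r add0r.
by rewrite -gauss_sub // !mulrA G0G // !mul0r.
Qed.

Lemma G0_der_Gr X : G 0 * d (G r * X) = closing * X.
Proof.
rewrite -{1}(G_idem r) -[G r * G r * X]mulrA dM mulrDr [G 0 * (G r * _)]mulrA.
by rewrite G0G ?r_gt0 /= // mul0r addr0 !mulrA.
Qed.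

Lemma G0_der_span_lt l X : (l < r)%N -> in_span l X -> G 0 * d X = 0.
Proof.
move=> lr [Z ->]; rewrite der_sum mulr_sumr big1 // => i _.
by rewrite G0_der_G //= (leq_ltn_trans _ lr).
Qed.

Lemma G0_der_span X : in_span r X -> exists Y, G 0 * d X = closing * Y.
Proof.
move=> [Z ->]; rewrite der_sum mulr_sumr; case: r r_gt0 G0_der_G G0_der_Gr => //.
move=> r' _ lt_case eq_case.
exists (Z r'); rewrite big_ord_recr /= eq_case big1 ?add0r // => i _.
by apply: lt_case; rewrite /= ltnS ltn_ord.
Qed.

Lemma awayD X Y : away (X + Y) = away X + away Y.
Proof. by rewrite /away dD mulrDr. Qed.

Lemma away_G i X : (0 < i < r)%N ->
  away (G i * X) = G i * d (G i * X) + G i.+1 * (gauss i * X).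
Proof.
move=> /andP[i0 ir]; rewrite /away [in LHS]der_G mulrDr.
have Ge j Y : (0 < j <= r)%N -> (1 - G 0) * (G j * Y) = G j * Y.
  by move=> jr; rewrite mulrA mulrBl mul1r G0G // subr0.
rewrite Ge ?i0 1?ltnW //; congr (_ + _).
by rewrite -[in LHS](gauss_sub ir) -mulrA Ge.
Qed.

Lemma away_span l X : (l < r)%N -> in_span l X -> in_span l.+1 (away X).
Proof.
move=> lr [Z ->]; rewrite /away der_sum mulr_sumr; apply: in_span_sum => i.
have il := ltn_ord i.
rewrite -/(away _) away_G ?(leq_ltn_trans _ lr) //.
by apply: in_spanD; apply: in_spanG; rewrite /= ?ltnS // ltnW.
Qed.

Lemma G_chain i : (i <= r)%N -> G i * chain i = chain i.
Proof. by case: i => [|i] ir /=; rewrite ?G_idem // mulrA gauss_sub. Qed.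

(** Each step stays in the current Gauss bundle or advances to the next. Only the path that always
    advances reaches [G i.+1]; [W] collects those lagging behind. *)
Lemma iter_away i X : (i < r)%N -> exists2 W, in_span i W &
  iter i.+1 away (G 0 * X) = chain i.+1 * X + W.
Proof.
elim: i => [|i IH] ir.
  exists 0; first exact: in_span0.
  rewrite /away [iter 1 _ _]/= der_G mulrDr [_ * (G 0 * _)]mulrA.
  rewrite [(1 - G 0) * G 0]mulrBl mul1r G_idem subrr mul0r add0r addr0.
  rewrite -[in LHS](gauss_sub ir) mulrBl mul1r.
  rewrite -[G 1 * gauss 0 * X]mulrA [G 0 * (G 1 * _)]mulrA G0G ?ir // mul0r.
  rewrite subr0 [LHS]mulrA gauss_sub //= /gauss /fundform.
  by rewrite -[X in _ = X * _]mulrA G_idem.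
have [W Ws E] := IH (ltnW ir).
exists (G i.+1 * d (G i.+1 * (chain i.+1 * X)) + away W).
  apply: in_spanD; last exact: away_span (ltnW ir) Ws.
  by apply: in_spanG; rewrite /= leqnn.
rewrite iterS E awayD addrA -[chain i.+1 in LHS](G_chain (ltnW ir)) -mulrA.
rewrite away_G ?ir // [X in X + _ = _]addrC; congr (_ + _ + _).
by rewrite [chain i.+2]/= mulrA gauss_sub // mulrA.
Qed.

(** After [i < r] steps a path is still in [G 1], ..., [G i], whose derivatives are orthogonal to
    [G 0]. *)
Lemma return_early i X : (0 < i < r)%N ->
  G 0 * d (iter i away (G 0 * X)) = 0.
Proof.
case: i => // i /andP[_ ir]; have [W Ws ->] := iter_away X (ltnW ir).
rewrite dD mulrDr (G0_der_span_lt (ltnW ir) Ws) addr0.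
by rewrite -(G_chain (ltnW ir)) -mulrA G0_der_G.
Qed.

Lemma return_first X : G 0 * d (iter r away (G 0 * X)) = return1 * X.
Proof.
rewrite /return1.
have rE : r = r.-1.+1 by rewrite prednK.
rewrite [in LHS]rE; have [|W Ws ->] := @iter_away r.-1 X; first by rewrite -rE.
rewrite dD mulrDr (G0_der_span_lt _ Ws) ?addr0 -?rE //.
by rewrite -{1}(G_chain (leqnn r)) -mulrA G0_der_Gr mulrA.
Qed.

(** One step beyond [G r] leads to the remainder, modulo the span of [G 1], ..., [G r]. That span
    returns to [G 0] only through [closing], which gives the error term. *)
Lemma return_second X : exists Y,
  G 0 * d (iter r.+1 away (G 0 * X)) = return2 * X + closing * Y.
Proof.
have rE : r = r.-1.+1 by rewrite prednK.
have [|W Ws E] := @iter_away r.-1 X; first by rewrite -rE.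
rewrite -rE in E; rewrite iterS E awayD.
set Y0 := chain r * X; set U := d (G r) * G r * Y0.
have Y0E : G r * Y0 = Y0 by rewrite mulrA G_chain.
have mod_span A B : in_span r (A - B) -> exists Y, G 0 * d A = G 0 * d B + closing * Y.
  by move=> /G0_der_span[Y YE]; exists Y; rewrite -YE -mulrDr -dD addrC subrK.
(* Since [G 0 * rest = 0], the derivative may fall on the first [rest] only. *)
have -> : return2 * X = G 0 * d (rest * (rest * (rest * U))).
  rewrite dM mulrDr [_ * (rest * d _)]mulrA G0_rest mul0r addr0.
  by rewrite /return2 /fundform /U /Y0 !mulrA.
apply: mod_span.
have spW : in_span r (away W) by rewrite rE; apply: away_span; rewrite -?rE.
(* Three congruences modulo [in_span r]: [1 - G 0] agrees with [rest], the component of [d Y0] in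
   [G r] is negligible after [rest], and [rest] is idempotent. *)
have sp1 Z : in_span r ((1 - G 0) * Z - rest * Z).
  rewrite -mulrBl /rest big_ord_recl [in X in _ - X]opprD [in X in _ - X]addrA subKr.
  rewrite mulr_suml; apply: in_span_sum => j; apply: in_spanG.
  by rewrite lift0 ltn_ord.
have sp2 : in_span r (rest * d Y0 - rest * U).
  have -> : rest * d Y0 - rest * U = rest * (G r * d Y0).
    by rewrite -mulrBr /U -[_ * Y0]mulrA Y0E -{1}Y0E dM addrAC subrr add0r.
  by apply: in_span_restG; rewrite r_gt0 leqnn.
have sp3 Z : in_span r (rest * Z - rest * (rest * Z)).
  rewrite -mulrBr -[X in X - _]mul1r -mulrBl [in X in _ * (X * _)]subKr.
  rewrite big_ord_recl [X in _ * X]mulrDl mulrDr [rest * (G 0 * _)]mulrA.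
  rewrite rest_G0 mul0r add0r.
  rewrite mulr_suml mulr_sumr; apply: in_span_sum => j; apply: in_span_restG.
  by rewrite lift0 ltn_ord.
have -> : away Y0 + away W - rest * (rest * (rest * U)) =
  away W + (away Y0 - rest * d Y0) + (rest * d Y0 - rest * U)
   + (rest * U - rest * (rest * U))
   + (rest * (rest * U) - rest * (rest * (rest * U))).
  by rewrite !addrA !subrK [away W + _]addrC.
by do 4?apply: in_spanD => //; exact: sp1.
Qed.

(** * Powers of the pencil decomposed by returns *)

Section Bounded.
Hypothesis closing0 : return1 * closing = 0.
(** The coefficient [(2 * G 0 - 1) * d (G 0)] is A_z of the Cartan embedding of [G 0]. *)
Hypothesis bounded :
  exists m : int, pencil_bounded ((2 * G 0 - 1) * d (G 0)) m.

Section Start.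
Variable s : V.
Hypothesis G0s : G 0 * s = s.

Definition orbit (N : nat) : int -> V :=
  iter N (pencil ((2 * G 0 - 1) * d (G 0))) (fun j => if j == 0 then s else 0).
(** The number of steps is an integer, with value 0 for negative counts, so that the recursions may
    subtract freely. *)
Definition orbit0 (N j : int) : V :=
  if N is Posz n then G 0 * orbit n j else 0.
Definition orbit1 (N j : int) : V :=
  if N is Posz n then (1 - G 0) * orbit n j else 0.

Lemma orbitS n j : orbit n.+1 j =
  pencil ((2 * G 0 - 1) * d (G 0)) (orbit n) j.
Proof. by []. Qed.

Lemma orbit0_G0 N j : G 0 * orbit0 N j = orbit0 N j.
Proof. by case: N => n /=; rewrite ?mulr0 // mulrA G_idem. Qed.

(** The pencil is [d] with its components crossing between [G 0] and its complement multiplied by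
    mu: a step within either side costs nothing, a crossing costs one power. At [N = 0] the identity
    uses that [s] lies in [G 0]. *)
Lemma orbit1_rec N j :
  orbit1 N j = away (orbit1 (N - 1) j) + away (orbit0 (N - 1) (j - 1)).
Proof.
have a0 : away 0 = 0 by rewrite /away der0 mulr0.
case: N => [[|n]|n]; last by rewrite /= a0 addr0.
  rewrite /= a0 addr0; case: eqP => _; rewrite ?mulr0 //.
  by rewrite mulrBl mul1r G0s subrr.
have -> : (n.+1%:Z - 1) = n%:Z by lia.
rewrite /orbit0 /orbit1 orbitS /pencil /away.
move: (orbit n j) (orbit n (j - 1)) => t t'.
have eG : (1 - G 0) * G 0 = 0 by rewrite mulrBl mul1r G_idem subrr.
have ee : (1 - G 0) * (1 - G 0) = 1 - G 0 by rewrite mulrBr mulr1 eG subr0.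
have ea : (1 - G 0) * ((2 * G 0 - 1) * d (G 0)) = - ((1 - G 0) * d (G 0)).
  by rewrite mulrA mulrBr mulr1 mulr_natl mulrnAr eG mul0rn sub0r mulNr.
have -> : (1 - G 0) * d ((1 - G 0) * t) =
    (1 - G 0) * d t - (1 - G 0) * d (G 0) * t.
  by rewrite dM derC mulrDr mulrA mulrN mulNr mulrA ee addrC.
have -> : (1 - G 0) * d (G 0 * t') = (1 - G 0) * d (G 0) * t'.
  by rewrite dM mulrDr !mulrA eG mul0r addr0.
rewrite mulrBr mulrDr ![_ * (_ * d (G 0) * _)]mulrA ea !mulNr opprK //.
Qed.

Lemma orbit0_rec (N j : int) : (N, j) != (0, 0) ->
  orbit0 N j = G 0 * d (orbit0 (N - 1) j) + G 0 * d (orbit1 (N - 1) (j - 1)).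
Proof.
case: N => [[|n]|n] Nj; last by rewrite /= der0 mulr0 addr0.
  rewrite /= der0 mulr0 addr0 ifN ?mulr0 //.
have -> : (n.+1%:Z - 1) = n%:Z by lia.
rewrite /orbit0 /orbit1 orbitS /pencil.
move: (orbit n j) (orbit n (j - 1)) => t t'.
have Ge : G 0 * (1 - G 0) = 0 by rewrite mulrBr mulr1 G_idem subrr.
have Ga : G 0 * ((2 * G 0 - 1) * d (G 0)) = G 0 * d (G 0).
  by rewrite mulrA mulrBr mulr1 mulr_natl mulrnAr G_idem mulr2n addrK.
have -> : G 0 * d (G 0 * t) = G 0 * d t + G 0 * d (G 0) * t.
  by rewrite dM mulrDr !mulrA G_idem addrC.
have -> : G 0 * d ((1 - G 0) * t') = - (G 0 * d (G 0) * t').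
  by rewrite dM derC mulrDr !mulrA Ge mul0r addr0 mulrN mulNr.
by rewrite mulrBr mulrDr ![_ * (_ * d (G 0) * _)]mulrA Ga.
Qed.

Lemma orbit1_eq0 (N j : int) :
  (forall M : int, M < N -> orbit0 M (j - 1) = 0) -> orbit1 N j = 0.
Proof.
have a0 : away 0 = 0 by rewrite /away der0 mulr0.
case: N => [n|//]; elim: n => [|n IH] P0; rewrite orbit1_rec P0; try lia.
  by rewrite a0 addr0.
have -> : (n.+1%:Z - 1) = n%:Z by lia.
by rewrite IH ?a0 ?addr0 // => M Mn; apply: P0; lia.
Qed.

Lemma iter_away0 i : iter i away 0 = 0.
Proof. by elim: i => //= i ->; rewrite /away der0 mulr0. Qed.

Definition second (X : V) : V := G 0 * d (iter r.+1 away (G 0 * X)).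

(** Split according to the end of the path: a step inside [G 0], or an excursion of [r + 1] or
    [r + 2] steps. An excursion crosses twice, hence the shift of [j] by 2; [P0] removes the longer
    ones. *)
Lemma orbit0_returns (N j : int) : (N, j) != (0, 0) ->
  (forall M : int, M < N - r%:Z - 2 -> orbit0 M (j - 2) = 0) ->
  orbit0 N j = G 0 * d (orbit0 (N - 1) j)
    + return1 * orbit0 (N - 1 - r%:Z) (j - 2)
    + second (orbit0 (N - 1 - r%:Z - 1) (j - 2)).
Proof.
move=> Nj P0; rewrite orbit0_rec // -addrA; congr (_ + _).
have iterD i : {morph iter i away : X Y / X + Y}.
  by elim: i => [|i IH] X Y //=; rewrite IH awayD.
have step i M : G 0 * d (iter i away (orbit1 M (j - 1))) =
    G 0 * d (iter i.+1 away (orbit1 (M - 1) (j - 1))) +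
    G 0 * d (iter i.+1 away (G 0 * orbit0 (M - 1) (j - 2))).
  rewrite orbit1_rec iterD dD mulrDr -!iterSr orbit0_G0.
  by have -> : j - 1 - 1 = j - 2 by lia.
(* Tracing the excursion backwards, the paths that left [G 0] too recently contribute nothing by
   [return_early]. *)
have early i : (i < r)%N -> G 0 * d (orbit1 (N - 1) (j - 1)) =
    G 0 * d (iter i away (orbit1 (N - 1 - i%:Z) (j - 1))).
  elim: i => [|i IH] ir; first by rewrite subr0.
  rewrite IH 1?ltnW // step return_early ?addr0 //.
  by have -> : N - 1 - i%:Z - 1 = N - 1 - i.+1%:Z by lia.
rewrite (early r.-1) ?ltn_predL // step prednK //.
have -> : N - 1 - r.-1%:Z - 1 = N - 1 - r%:Z by move: r_gt0; lia.
rewrite return_first addrC; congr (_ + _).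
(* What remains has been away for more than [r + 2] steps and started from terms that vanish by
   [P0]. *)
rewrite step orbit1_eq0 => [|M MN].
  by rewrite iter_away0 der0 mulr0 add0r.
have -> : j - 1 - 1 = j - 2 by lia.
by apply: P0; lia.
Qed.

(** With [rho] returns the power of mu is [2 * rho]; a return takes at least [r + 1] steps, and [x]
    counts the steps in excess of this, including those inside [G 0]. *)
Definition word_sum (rho x : int) : V := orbit0 (x + r.+1%:Z * rho) (2 * rho).

Lemma word_sum_neg (rho x : int) : x + r.+1%:Z * rho < 0 -> word_sum rho x = 0.
Proof. by rewrite /word_sum; case: (x + _). Qed.

Lemma word_sum_start : word_sum 0 0 = s.
Proof. by rewrite /word_sum !mulr0. Qed.

Lemma word_sum_rec (rho x : int) : (rho, x) != (0, 0) ->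
  (forall y : int, y < x - 1 -> word_sum (rho - 1) y = 0) ->
  word_sum rho x = G 0 * d (word_sum rho (x - 1)) +
    return1 * word_sum (rho - 1) x + second (word_sum (rho - 1) (x - 1)).
Proof.
move=> nz w0; rewrite /word_sum orbit0_returns.
- congr (_ * d (orbit0 _ _) + _ * orbit0 _ _ + second (orbit0 _ _)); lia.
- by move: nz; rewrite !xpair_eqE; lia.
- move=> M ltM; have := w0 (M - r.+1%:Z * (rho - 1)); rewrite /word_sum subrK.
  have -> : 2 * (rho - 1) = 2 * rho - 2 by lia.
  by apply; lia.
Qed.

Lemma word_sum_eq0 : exists m : int, forall rho x : int, m < rho -> word_sum rho x = 0.
Proof.
have [m mP] := bounded; exists `|m| => rho x ltm.
rewrite /word_sum /orbit0; case: (x + _) => // n.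
by rewrite /orbit mP ?mulr0 // => [j j0|]; [rewrite gt_eqF|lia].
Qed.

End Start.

Lemma second0 : second 0 = 0.
Proof.
by rewrite /second mulr0 iter_away0 der0 mulr0.
Qed.

Lemma return1_second v : return1 * second v = return1 * return2 * v.
Proof.
by have [Y E] := return_second v; rewrite /second E mulrDr
  (mulrA _ closing) closing0 mul0r addr0 mulrA.
Qed.

Lemma G0_return1 : G 0 * return1 = return1.
Proof. by rewrite /return1 /closing /fundform !mulrA G_idem. Qed.

Hypothesis return1_sq : return1 * return1 = 0.

Let der_G00 : G 0 * d 0 = 0.
Proof. by rewrite der0 mulr0. Qed.

(** The alternating word with [2m] returns is a coefficient of mu of degree [4m], which the uniform
    bound kills for large [m]. *)
Lemma return12_nilpotent : exists m, (return1 * return2) ^+ m * return1 = 0.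
Proof.
have G0s : G 0 * return1 = return1 by exact: G0_return1.
have [m mP] := word_sum_eq0 return1; exists `|m|.+1.
rewrite -(words_alternating (D := fun X => G 0 * d X) der_G00 second0
  (@word_sum_neg _) (word_sum_start G0s) (word_sum_rec G0s)) //.
- by apply: mP; lia.
- exact: return1_second.
Qed.

Hypothesis return12_sq : return1 * return2 * return1 * return2 * return1 = 0.
Hypothesis closing12 : return1 * return2 * return1 * return2 * closing = 0.

Lemma return122_nilpotent : exists m,
  (return1 * return2 * return1 * return2 * return2) ^+ m *
  (return1 * return2 * return1) = 0.
Proof.
set s := return1 * return2 * return1.
have G0s : G 0 * s = s by rewrite /s 2!mulrA G0_return1.
have [m mP] := word_sum_eq0 s; exists `|m|.+1.
rewrite -(words_alternating2 (D := fun X => G 0 * d X) der_G00 second0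
  (@word_sum_neg _) (word_sum_start G0s) (word_sum_rec G0s)) //.
- by apply: mP; lia.
- exact: return1_second.
- move=> v; have [Y E] := return_second v.
  by rewrite /second E mulrDr (mulrA _ closing) closing12 mul0r addr0 mulrA.
- by rewrite /s 2!mulrA return1_sq !mul0r.
- by rewrite /s 2!mulrA return12_sq.
Qed.
End Bounded.
End Returns.
End Derivation.

(** * The ring of smooth matrix fields on a chart *)

Section SmoothFunctions.
Variables (R : realType) (U : set (R * R)).
Hypothesis U_open : open U.
Implicit Types f g : R * R -> R.

Lemma Ck_weak k f : Ck k.+1 U f -> Ck k U f.
Proof.
elim: k f => [|k IH] f; first by case.
move=> [cf [df d1 d2]].
exact: (conj cf (And3 df (IH _ d1) (IH _ d2))).
Qed.

Lemma near_open x : U x -> \forall y \near x, U y.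
Proof. by move=> Ux; exact: open_nbhs_nbhs. Qed.

Lemma e1_neq0 : (1, 0) != 0 :> R * R.
Proof. by rewrite xpair_eqE oner_eq0. Qed.
Lemma e2_neq0 : (0, 1) != 0 :> R * R.
Proof. by rewrite xpair_eqE oner_eq0 andbF. Qed.

Lemma near_continuous_at f g x : (\forall y \near x, f y = g y) ->
  {for x, continuous f} -> {for x, continuous g}.
Proof.
move=> fg cf; have E : f x = g x := nbhs_singleton fg.
suff : g @ x --> g x by [].
by rewrite -E; apply: cvg_trans cf; apply: near_eq_cvg.
Qed.

(** As [U] is open, equality on it is equality near each of its points, so the derivatives agree as
    well. *)
Lemma eq_Ck k f g : (forall x, U x -> f x = g x) -> Ck k U f -> Ck k U g.
Proof.
elim: k f g => [|k IH] f g fg.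
  move=> [cf _]; split; last exact: I.
  move=> x Ux; apply: near_continuous_at (cf x Ux).
  by apply: filterS (near_open Ux) => y /fg.
have nfg x : U x -> \forall y \near x, f y = g y.
  by move=> Ux; apply: filterS (near_open Ux) => y /fg.
move=> [cf [df d1 d2]]; split.
  by move=> x Ux; apply: near_continuous_at (cf x Ux); exact: nfg.
split.
- move=> x Ux; have [a b] := df x Ux; split.
    by apply: near_eq_derivable a; rewrite ?e1_neq0//; exact: nfg.
  by apply: near_eq_derivable b; rewrite ?e2_neq0//; exact: nfg.
- by apply: IH d1 => x Ux; apply: near_eq_derive; rewrite ?e1_neq0//; exact: nfg.
- by apply: IH d2 => x Ux; apply: near_eq_derive; rewrite ?e2_neq0//; exact: nfg.
Qed.

Lemma Ck_cst k a : Ck k U (fun=> a).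
Proof.
elim: k a => [|k IH] a; split=> //; try by move=> x _; exact: cvg_cst.
have -> v : 'D_v (fun=> a : R) = (fun=> 0 : R).
  by apply/funext => x; rewrite derive_cst.
by split=> // x _; split; exact: derivable_cst.
Qed.

Lemma CkD k f g : Ck k U f -> Ck k U g -> Ck k U (fun x => f x + g x).
Proof.
elim: k f g => [|k IH] f g [cf df] [cg dg]; (split;
  first by move=> x Ux; exact: cvgD (cf x Ux) (cg x Ux)) => //.
have [df0 df1 df2] := df; have [dg0 dg1 dg2] := dg.
split.
- move=> x Ux; have [a b] := df0 x Ux; have [a' b'] := dg0 x Ux.
  by split; [exact: derivableD a a'|exact: derivableD b b'].
- apply: eq_Ck (IH _ _ df1 dg1) => x Ux.
  by rewrite (deriveD (df0 x Ux).1 (dg0 x Ux).1).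
- apply: eq_Ck (IH _ _ df2 dg2) => x Ux.
  by rewrite (deriveD (df0 x Ux).2 (dg0 x Ux).2).
Qed.

Lemma CkM k f g : Ck k U f -> Ck k U g -> Ck k U (fun x => f x * g x).
Proof.
elim: k f g => [|k IH] f g Cf Cg; have [cf df] := Cf; have [cg dg] := Cg; (split;
  first by move=> x Ux; exact: cvgM (cf x Ux) (cg x Ux)) => //.
have [df0 df1 df2] := df; have [dg0 dg1 dg2] := dg.
have f' := Ck_weak Cf; have g' := Ck_weak Cg.
split.
- move=> x Ux; have [a b] := df0 x Ux; have [a' b'] := dg0 x Ux.
  by split; [exact: derivableM a a'|exact: derivableM b b'].
- apply: eq_Ck (CkD (IH _ _ f' dg1) (IH _ _ g' df1)) => x Ux.
  by rewrite (deriveM (df0 x Ux).1 (dg0 x Ux).1).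
- apply: eq_Ck (CkD (IH _ _ f' dg2) (IH _ _ g' df2)) => x Ux.
  by rewrite (deriveM (df0 x Ux).2 (dg0 x Ux).2).
Qed.
End SmoothFunctions.

Lemma Ck_sub (R : realType) (U W : set (R * R)) k (f : R * R -> R) :
  W `<=` U -> Ck k U f -> Ck k W f.
Proof.
move=> WU; elim: k f => [|k IH] f.
  by move=> [cf _]; split; [move=> x /WU/cf|exact: I].
move=> [cf [df d1 d2]]; split; first by move=> x /WU/cf.
by split; [move=> x /WU/df|exact: IH|exact: IH].
Qed.

(** * Smooth complex functions and the Wirtinger derivative *)

Section SmoothComplexFunctions.
Variables (R : realType) (U : set (R * R)).
Hypothesis U_open : open U.
Local Notation C := R[i].
Implicit Types f g : R * R -> C.

Lemma eq_Cinfty f g : (forall x, U x -> f x = g x) -> Cinfty U f -> Cinfty U g.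
Proof.
move=> fg Cf k; have [Cr Ci] := Cf k.
by split; [move: Cr|move: Ci]; apply: (eq_Ck U_open) => x /fg ->.
Qed.

Lemma Cinfty_cst (a : C) : Cinfty U (fun=> a).
Proof. by split; exact: Ck_cst. Qed.

Lemma CinftyD f g : Cinfty U f -> Cinfty U g -> Cinfty U (fun x => f x + g x).
Proof.
move=> Cf Cg k; have [fr fi] := Cf k; have [gr gi] := Cg k.
split; [apply: (eq_Ck U_open) (CkD U_open fr gr)
       |apply: (eq_Ck U_open) (CkD U_open fi gi)] => x _;
by case: (f x) (g x) => ? ? [].
Qed.

Lemma CinftyM f g : Cinfty U f -> Cinfty U g -> Cinfty U (fun x => f x * g x).
Proof.
move=> Cf Cg k; have [fr fi] := Cf k; have [gr gi] := Cg k.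
split.
  have := CkD U_open (CkM U_open fr gr)
    (CkM U_open (Ck_cst U k (-1)) (CkM U_open fi gi)).
  by apply: (eq_Ck U_open) => x _; case: (f x) (g x) => ? ? [? ?]; rewrite mulN1r.
have := CkD U_open (CkM U_open fr gi) (CkM U_open fi gr).
by apply: (eq_Ck U_open) => x _; case: (f x) (g x) => ? ? [? ?] /=.
Qed.

Lemma Cinfty_sum (I : finType) (F : I -> R * R -> C) :
  (forall i, Cinfty U (F i)) -> Cinfty U (fun x => \sum_i F i x).
Proof.
move=> CF; have E : (fun x => \sum_i F i x) = \sum_i F i.
  by apply/funext => x; rewrite fct_sumE.
rewrite E; elim/big_ind: _ => [|f g|i _] //; first exact: Cinfty_cst.
exact: CinftyD.
Qed.

Lemma Cinfty_partial f : Cinfty U f ->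
  Cinfty U (partial (1, 0) f) /\ Cinfty U (partial (0, 1) f).
Proof.
by move=> Cf; split=> k; have [[_ [_ r1 r2]] [_ [_ i1 i2]]] := Cf k.+1.
Qed.

Lemma Cinfty_wirtinger f : Cinfty U f -> Cinfty U (wirtinger f).
Proof.
move=> /Cinfty_partial[C1 C2].
have := CinftyM (Cinfty_cst 2^-1)
  (CinftyD C1 (CinftyM (Cinfty_cst (- 'i%C)) C2)).
by apply: eq_Cinfty => x _; rewrite /wirtinger mulNr.
Qed.

Lemma near_wirtinger f g x : (\forall y \near x, f y = g y) ->
  wirtinger f x = wirtinger g x.
Proof.
by move=> fg; rewrite /wirtinger !(near_partial _ fg) ?e1_neq0 ?e2_neq0.
Qed.

Lemma wirtingerD f g x : Cinfty U f -> Cinfty U g -> U x ->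
  wirtinger (fun y => f y + g y) x = wirtinger f x + wirtinger g x.
Proof.
move=> Cf Cg Ux; have [f1 f2] := Cinfty_derivable Cf Ux.
have [g1 g2] := Cinfty_derivable Cg Ux.
by rewrite /wirtinger (partialD f1 g1).2 (partialD f2 g2).2; ring.
Qed.

Lemma wirtingerM f g x : Cinfty U f -> Cinfty U g -> U x ->
  wirtinger (fun y => f y * g y) x = wirtinger f x * g x + f x * wirtinger g x.
Proof.
move=> Cf Cg Ux; have [f1 f2] := Cinfty_derivable Cf Ux.
have [g1 g2] := Cinfty_derivable Cg Ux.
by rewrite /wirtinger (partialM f1 g1).2 (partialM f2 g2).2; ring.
Qed.

Lemma wirtinger_cst (a : C) x : wirtinger (fun=> a) x = 0.
Proof.
rewrite /wirtinger /partial !derive_cst.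
by rewrite mulr0 subrr mulr0.
Qed.

Lemma wirtinger_sum (I : finType) (F : I -> R * R -> C) x :
  (forall i, Cinfty U (F i)) -> U x ->
  wirtinger (fun y => \sum_i F i y) x = \sum_i wirtinger (F i) x.
Proof.
move=> CF Ux; have E : (fun x => \sum_i F i x) = \sum_i F i.
  by apply/funext => y; rewrite fct_sumE.
rewrite E; suff [_ ->] : Cinfty U (\sum_i F i) /\
  wirtinger (\sum_i F i) x = \sum_i wirtinger (F i) x by [].
elim/big_ind2: _ => [|f a g b [Cf <-] [Cg <-]|i _] //.
  by split; [exact: Cinfty_cst|exact: wirtinger_cst].
by split; [exact: CinftyD|exact: wirtingerD].
Qed.
End SmoothComplexFunctions.

(** * Smooth matrix fields as a ring with derivation *)

Section SmoothMatrixRing.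
Variables (R : realType) (M : topologicalType) (u : chart R M) (n : nat).
Local Notation C := R[i].

Definition chart_range : set (R * R) := zcoord u @` cdom u.

Lemma open_chart_range : open chart_range. Proof. exact: crange_open. Qed.

(* A smooth matrix-valued function on the range of the chart u, extended by
   zero to the plane. *)
Definition smooth_field : {pred R * R -> 'M[C]_n} := fun f =>
  `[< (forall i j, Cinfty chart_range (fun x => f x i j)) /\
      (forall x, ~ chart_range x -> f x = 0) >].

Lemma smooth_fieldP (f : R * R -> 'M[C]_n) :
  reflect ((forall i j, Cinfty chart_range (fun x => f x i j)) /\
           (forall x, ~ chart_range x -> f x = 0)) (f \in smooth_field).
Proof. exact: asboolP. Qed.

Lemma smooth_field_zmod : zmod_closed smooth_field.
Proof.
split.
  by apply/smooth_fieldP; split=> // i j; under eq_fun do rewrite mxE; exact: Cinfty_cst.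
move=> f g /smooth_fieldP[sf f0] /smooth_fieldP[sg g0]; apply/smooth_fieldP.
split=> [i j|x nx]; last by rewrite !fctE f0 // g0 // subr0.
have := CinftyD open_chart_range (sf i j)
  (CinftyM open_chart_range (Cinfty_cst chart_range (-1)) (sg i j)).
by apply: (eq_Cinfty open_chart_range) => x _; rewrite !mxE mulN1r.
Qed.

HB.instance Definition _ :=
  GRing.isZmodClosed.Build (R * R -> 'M[C]_n) smooth_field smooth_field_zmod.

Record field_ring :=
  FieldRing { field_val :> R * R -> 'M[C]_n; _ : field_val \in smooth_field }.

HB.instance Definition _ := [isSub for field_val].
HB.instance Definition _ := [Choice of field_ring by <:].
HB.instance Definition _ := [SubChoice_isSubZmodule of field_ring by <:].

Lemma field_smooth (f : field_ring) i j : Cinfty chart_range (fun x => f x i j).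
Proof. by have /smooth_fieldP[+ _] := valP f; apply. Qed.

Lemma field_out (f : field_ring) x : ~ chart_range x -> f x = 0.
Proof. by have /smooth_fieldP[_ +] := valP f; apply. Qed.

Lemma field_eqP (f g : field_ring) : (forall x, chart_range x -> f x = g x) -> f = g.
Proof.
move=> fg; apply/val_inj/funext => x.
by have [/fg//|nx] := pselect (chart_range x); rewrite /= !field_out.
Qed.

Lemma field_one_subproof :
  (fun x => if `[< chart_range x >] then 1%:M : 'M[C]_n else 0) \in smooth_field.
Proof.
apply/smooth_fieldP; split=> [i j|x nx]; last by rewrite asboolF.
apply: (eq_Cinfty open_chart_range)
  (Cinfty_cst chart_range ((1%:M : 'M[C]_n) i j)) => x rx.
by rewrite asboolT.
Qed.

Lemma field_mul_subproof (f g : field_ring) :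
  (fun x => f x *m g x) \in smooth_field.
Proof.
apply/smooth_fieldP; split=> [i j|x nx]; last by rewrite field_out // mul0mx.
under eq_fun do rewrite mxE.
apply: (Cinfty_sum open_chart_range) => k.
by apply: (CinftyM open_chart_range); exact: field_smooth.
Qed.

Definition field_one := FieldRing field_one_subproof.
Definition field_mul f g := FieldRing (field_mul_subproof f g).

Lemma field_mulA : associative field_mul.
Proof. by move=> f g h; apply: field_eqP => x _ /=; rewrite mulmxA. Qed.
Lemma field_mul1l : left_id field_one field_mul.
Proof. by move=> f; apply: field_eqP => x rx /=; rewrite asboolT // mul1mx. Qed.
Lemma field_mul1r : right_id field_one field_mul.
Proof. by move=> f; apply: field_eqP => x rx /=; rewrite asboolT // mulmx1. Qed.
Lemma field_mulDl : left_distributive field_mul +%R.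
Proof. by move=> f g h; apply: field_eqP => x rx /=; rewrite mulmxDl. Qed.
Lemma field_mulDr : right_distributive field_mul +%R.
Proof. by move=> f g h; apply: field_eqP => x rx /=; rewrite mulmxDr. Qed.

(** The ring is trivial for [n = 0] or an empty chart, so nothing is asked about 1 and 0 being
    distinct. *)
HB.instance Definition _ := GRing.Zmodule_isPzRing.Build field_ring
  field_mulA field_mul1l field_mul1r field_mulDl field_mulDr.

Lemma fieldME (f g : field_ring) x : (f * g) x = f x *m g x.
Proof. by []. Qed.
Lemma fieldDE (f g : field_ring) x : (f + g) x = f x + g x.
Proof. by []. Qed.
Lemma fieldNE (f : field_ring) x : (- f) x = - f x.
Proof. by []. Qed.
Lemma field0E x : (0 : field_ring) x = 0.
Proof. by []. Qed.
Lemma field1E x : chart_range x -> (1 : field_ring) x = 1%:M.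
Proof. by move=> rx /=; rewrite asboolT. Qed.
Lemma field_sumE (I : finType) (F : I -> field_ring) x :
  (\sum_i F i) x = \sum_i F i x.
Proof.
by apply: (big_morph (fun f : field_ring => f x) (fun f g => fieldDE f g x)
  (field0E x)).
Qed.
Lemma field_der_subproof (f : field_ring) :
  (fun x => if `[< chart_range x >]
     then \matrix_(i, j) wirtinger (fun y => f y i j) x else 0) \in smooth_field.
Proof.
apply/smooth_fieldP; split=> [i j|x nx]; last by rewrite asboolF.
apply: (eq_Cinfty open_chart_range)
  (Cinfty_wirtinger open_chart_range (field_smooth f i j)).
by move=> x rx; rewrite asboolT // mxE.
Qed.
Definition field_der f := FieldRing (field_der_subproof f).

Lemma field_derE (f : field_ring) x : chart_range x ->
  field_der f x = \matrix_(i, j) wirtinger (fun y => f y i j) x.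
Proof. by move=> rx /=; rewrite asboolT. Qed.

Lemma field_derD (f g : field_ring) : field_der (f + g) = field_der f + field_der g.
Proof.
apply: field_eqP => x rx; rewrite fieldDE !field_derE //.
apply/matrixP => i j; rewrite !mxE.
rewrite -(wirtingerD (field_smooth f i j) (field_smooth g i j) rx).
by congr (wirtinger _ x); apply/funext => y; rewrite mxE.
Qed.

Lemma field_derM (f g : field_ring) :
  field_der (f * g) = field_der f * g + f * field_der g.
Proof.
apply: field_eqP => x rx; rewrite fieldDE !fieldME !field_derE //.
apply/matrixP => i j; rewrite !mxE -big_split /=.
under [X in wirtinger X]funext do rewrite mxE.
rewrite (wirtinger_sum open_chart_range) //; last first.
  by move=> k; apply: (CinftyM open_chart_range); exact: field_smooth.
apply: eq_bigr => k _; rewrite !mxE.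
by rewrite (wirtingerM (field_smooth f i k) (field_smooth g k j) rx).
Qed.

End SmoothMatrixRing.
Arguments open_chart_range {R M} u.

Lemma near_not_isolated (R : realType) (x : R * R) (A : set (R * R)) :
  (\forall y \near x, A y) -> exists2 y, A y & y != x.
Proof.
move=> /nbhs_ballP[e /= e0 eA]; exists (x.1 + e / 2, x.2).
  apply: eA; split => /=; last exact: ballxx.
  rewrite /ball /= opprD addrA subrr sub0r normrN gtr0_norm ?divr_gt0 //.
  by rewrite ltr_pdivrMr // ltr_pMr // ltr1n.
apply/eqP => /(congr1 fst) /= /eqP.
by rewrite -subr_eq0 addrAC subrr add0r gt_eqF // divr_gt0.
Qed.

(** Filled-out images are described on punctured neighbourhoods; this carries identities over the
    missing point, which is not isolated in the plane. *)
Lemma continuous_punctured0 (R : realType) (f : R * R -> R) (x : R * R) :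
  {for x, continuous f} -> (\forall y \near x, y != x -> f y = 0) -> f x = 0.
Proof.
move=> cf f0; apply: contrapT => /eqP fx0.
have nf : \forall y \near x, f y != 0 by exact: cvgr_neq0 cf fx0.
have [y [f0y /negP fy] yx] := near_not_isolated (filterI f0 nf).
by apply: fy; rewrite f0y.
Qed.

(** * The conjugate Wirtinger derivative *)

Section WirtingerBar.
Variables (R : realType) (U : set (R * R)).
Hypothesis U_open : open U.
Local Notation C := R[i].
Implicit Types f g : R * R -> C.

Lemma Cinfty_conj f : Cinfty U f -> Cinfty U (fun x => (f x)^*).
Proof.
move=> Cf k; have [fr fi] := Cf k; split.
  by apply: (eq_Ck U_open) fr => x _; case: (f x).
apply: (eq_Ck U_open) (CkM U_open (Ck_cst U k (-1)) fi) => x _.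
by case: (f x) => a b /=; rewrite mulN1r.
Qed.

Lemma wirtinger_barE f x : Cinfty U f -> U x ->
  wirtinger_bar f x = (wirtinger (fun y => (f y)^*) x)^*.
Proof.
move=> Cf Ux; have [[r1 i1] [r2 i2]] := Cinfty_derivable Cf Ux.
have P v : derivable (fun y => complex.Im (f y)) x v ->
    partial v (fun y => (f y)^*) x = (partial v f x)^*.
  move=> iv; rewrite /partial /=.
  have -> : (fun y => complex.Re (f y)^*) = (fun y => complex.Re (f y)).
    by apply/funext => y; case: (f y).
  have -> : (fun y => complex.Im (f y)^*) = - (fun y => complex.Im (f y)).
    by apply/funext => y; rewrite fctE; case: (f y).
  by rewrite deriveN.
rewrite /wirtinger /wirtinger_bar !P //.
move: (partial _ _ _) (partial _ _ _) => [a b] [c d].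
rewrite rmorphM rmorphB rmorphM /= conjCK fmorphV /= conjC_nat; congr (_ * _).
by apply/eqP; rewrite eq_complex /= ; apply/andP; split; apply/eqP; ring.
Qed.

Lemma wirtinger_bar_lin (I : finType) (F : I -> R * R -> C) (w : I -> C) x :
  (forall i, Cinfty U (F i)) -> U x ->
  wirtinger_bar (fun y => \sum_i F i y * w i) x =
  \sum_i wirtinger_bar (F i) x * w i.
Proof.
move=> CF Ux.
have CFw i : Cinfty U (fun y => F i y * w i).
  exact: (CinftyM U_open (CF i) (Cinfty_cst U (w i))).
rewrite wirtinger_barE //; last exact: Cinfty_sum.
have -> : (fun y => (\sum_i F i y * w i)^*) = (fun y => \sum_i (F i y)^* * (w i)^*).
  by apply/funext => y; rewrite rmorph_sum; apply: eq_bigr => i _; rewrite rmorphM.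
have Cc i : Cinfty U (fun y => (F i y)^*) by exact: Cinfty_conj.
rewrite (wirtinger_sum U_open) // => [|i]; last first.
  exact: (CinftyM U_open (Cc i) (Cinfty_cst U _)).
rewrite rmorph_sum; apply: eq_bigr => i _.
rewrite (wirtingerM (Cc i) (Cinfty_cst U _) Ux) wirtinger_cst mulr0 addr0.
by rewrite rmorphM /= conjCK wirtinger_barE.
Qed.
End WirtingerBar.

(** * Unitons *)

Lemma eq_mulmx_col (C : pzSemiRingType) m n (A B : 'M[C]_(m, n)) :
  (forall w : 'cV[C]_n, A *m w = B *m w) -> A = B.
Proof.
by move=> AB; apply/matrixP => i j; have /colP/(_ i) := AB (delta_mx j 0);
  rewrite -!colE !mxE.
Qed.

Section Chart.
Variables (R : realType) (M : riemann_surface R) (n : nat).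
Local Notation C := R[i].
Variable u : chart R M.
Hypothesis u_atlas : atlas u.
Local Notation S := (field_ring u n).
Local Notation d := (@field_der R M u n).

Lemma chart_range_zcoord q : cdom u q -> chart_range u (zcoord u q).
Proof. by move=> uq; exists q. Qed.

Lemma field_eq_cdom (f g : S) :
  (forall q, cdom u q -> f (zcoord u q) = g (zcoord u q)) -> f = g.
Proof. by move=> fg; apply: field_eqP => _ [q uq <-]; exact: fg. Qed.

(** The default 0 of [insubd] is never met for smooth [psi]. *)
Definition field_of (psi : M -> 'M[C]_n) : S :=
  insubd 0 (fun x => if `[< chart_range u x >] then psi (cinv u x) else 0).

Lemma smooth_chart m p (psi : M -> 'M[C]_(m, p)) : smooth_on setT psi ->
  forall i j, Cinfty (chart_range u) (fun x => psi (cinv u x) i j).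
Proof. by move=> s i j; have := s u u_atlas i j; rewrite setIT. Qed.

Lemma field_ofE psi q : smooth_on setT psi -> cdom u q ->
  field_of psi (zcoord u q) = psi q.
Proof.
move=> s uq; rewrite /field_of insubdK; last first.
  apply/smooth_fieldP; split=> [i j|x nx]; last by rewrite asboolF.
  have := smooth_chart s i j; apply: eq_Cinfty => [|x rx].
    exact: open_chart_range.
  by rewrite asboolT.
by rewrite asboolT ?zcoordK //; exact: chart_range_zcoord.
Qed.

Lemma field_of_near psi q : smooth_on setT psi -> cdom u q ->
  \forall x \near zcoord u q, field_of psi x = psi (cinv u x).
Proof.
move=> s uq; apply: filterS (near_open (open_chart_range u) (chart_range_zcoord uq)).
by move=> _ [p up <-]; rewrite field_ofE // zcoordK.
Qed.

Lemma field_of_dz psi q : smooth_on setT psi -> cdom u q ->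
  d (field_of psi) (zcoord u q) = dz u psi q.
Proof.
move=> s uq; rewrite field_derE; last exact: chart_range_zcoord.
apply/matrixP => i j; rewrite !mxE; apply: near_wirtinger.
by apply: filterS (field_of_near s uq) => x ->.
Qed.

Lemma smooth_tc m p (psi : M -> 'M[C]_(m, p)) :
  smooth_on setT psi -> smooth_on setT (fun q => (psi q)^t*).
Proof.
move=> s v av i j; rewrite setIT.
have := s v av j i; rewrite setIT => /(Cinfty_conj (open_chart_range v)).
by apply: (eq_Cinfty (open_chart_range v)) => x _; rewrite !mxE.
Qed.

Lemma dzbarE (psi : M -> 'M[C]_n) q : smooth_on setT psi -> cdom u q ->
  dzbar u psi q = (dz u (fun q => (psi q)^t*) q)^t*.
Proof.
move=> s uq; apply/matrixP => i j; rewrite !mxE.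
rewrite (wirtinger_barE (smooth_chart s i j) (chart_range_zcoord uq)).
suff -> : (fun x => (psi (cinv u x))^t* j i) = (fun x => (psi (cinv u x) i j)^*) by [].
by apply/funext => x; rewrite !mxE.
Qed.

Lemma smooth_mul_cst (psi : M -> 'M[C]_n) (w : 'cV[C]_n) (V : set M) :
  smooth_on setT psi -> smooth_on V (fun q => psi q *m w).
Proof.
move=> s v av i j k.
have sub : zcoord v @` (cdom v `&` V) `<=` zcoord v @` cdom v.
  by move=> _ [q [vq _] <-]; exists q.
suff : Cinfty (zcoord v @` cdom v) (fun x => (psi (cinv v x) *m w) i j).
  by move=> /(_ k)[a b]; split; exact: Ck_sub sub _.
under eq_fun do rewrite mxE.
have o := open_chart_range v.
apply: (Cinfty_sum o) => l; apply: (CinftyM o); last exact: Cinfty_cst.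
by have := s v av i l; rewrite setIT.
Qed.

Lemma dzbar_mul_cst (psi : M -> 'M[C]_n) (w : 'cV[C]_n) q :
  smooth_on setT psi -> cdom u q ->
  dzbar u (fun q => psi q *m w) q = dzbar u psi q *m w.
Proof.
move=> s uq; apply/matrixP => i j; rewrite !mxE.
under [X in wirtinger_bar X]funext do rewrite mxE.
rewrite (wirtinger_bar_lin (open_chart_range u)) //; last exact: chart_range_zcoord.
  by apply: eq_bigr => k _; rewrite mxE.
by move=> k; exact: smooth_chart.
Qed.

Section Uniton.
Variables Phi al : M -> 'M[C]_n.
Hypothesis Phi_al : uniton Phi al.
Variable a : S.
Hypothesis aE : d (field_of Phi) = field_of Phi * (a + a).

Let Phi_smooth : smooth_on setT Phi. Proof. by case: Phi_al => -[]. Qed.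
Let al_smooth : smooth_on setT al. Proof. by case: Phi_al => _ []. Qed.
Let al_proj p : orthoproj (al p). Proof. by case: Phi_al => _ []. Qed.
Let Phi_unitary p : Phi p \is unitarymx. Proof. by case: Phi_al => -[]. Qed.

Lemma uniton_Az q : cdom u q -> Az u Phi q = a (zcoord u q).
Proof.
move=> uq; rewrite /Az -field_of_dz // aE fieldME field_ofE //.
rewrite mulKmx ?unitarymx_unit // fieldDE scalerDr -scalerDl.
have -> : 2^-1 + 2^-1 = 1 :> C by rewrite [RHS]splitr mul1r.
by rewrite scale1r.
Qed.

(** Differentiate the identity that the adjoint of [Phi] times [Phi] is 1. *)
Lemma uniton_Azbar q : cdom u q -> Azbar u Phi q = - (Az u Phi q)^t*.
Proof.
move=> uq; rewrite /Azbar /Az dzbarE //.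
have tc := smooth_tc Phi_smooth.
have PP : field_of (fun q => (Phi q)^t*) * field_of Phi = 1.
  apply: field_eq_cdom => p up; rewrite fieldME !field_ofE // field1E; last first.
    exact: chart_range_zcoord.
  by have /unitarymxP := Phi_unitary p; exact: mulmx1C.
have : d (field_of (fun q => (Phi q)^t*)) * field_of Phi +
       field_of (fun q => (Phi q)^t*) * d (field_of Phi) = 0.
  by rewrite -field_derM PP; apply: der1; exact: field_derM.
move=> /(congr1 (fun f : S => f (zcoord u q))).
rewrite fieldDE !fieldME !field_ofE // !field_of_dz // => /eqP.
rewrite addrC addr_eq0 => /eqP E.
rewrite invmx_unitary // E scalerN linearN /= map_mxN opprK.
rewrite linearZ /= map_mxZ fmorphV rmorph_nat; congr (_ *: _).
by rewrite trmx_mul map_mxM.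
Qed.

(** The closure conditions are tested on projections of constant vectors, which span every fibre. *)
Let uniton_section (w : 'cV[C]_n) q : cdom u q ->
  al q *m (dzbar u al q *m w + Azbar u Phi q *m (al q *m w)) =
    dzbar u al q *m w + Azbar u Phi q *m (al q *m w) /\
  al q *m (Az u Phi q *m (al q *m w)) = Az u Phi q *m (al q *m w).
Proof.
move=> uq; have [_ _ /(_ u (fun q => al q *m w) u_atlas)] := Phi_al.
move=> /(_ (smooth_mul_cst w (cdom u) al_smooth)).
have fib p : cdom u p -> in_fibre al p (al p *m w).
  by move=> _; rewrite /in_fibre mulmxA (al_proj p).2.
by move=> /(_ fib q uq); rewrite dzbar_mul_cst.
Qed.

Lemma field_of_idem : field_of al * field_of al = field_of al.
Proof.
by apply: field_eq_cdom => q uq; rewrite fieldME !field_ofE // (al_proj q).2.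
Qed.

Lemma field1BE (f : S) q : cdom u q ->
  (1 - f) (zcoord u q) = 1%:M - f (zcoord u q).
Proof. by move=> uq; rewrite fieldDE fieldNE field1E //; exact: chart_range_zcoord. Qed.

Lemma uniton_closed_Az : (1 - field_of al) * a * field_of al = 0.
Proof.
apply: field_eq_cdom => q uq; rewrite !fieldME field1BE // field_ofE //.
rewrite -uniton_Az //; apply: eq_mulmx_col => w; rewrite mul0mx.
have [_ E] := uniton_section w uq.
by rewrite -!mulmxA mulmxBl mul1mx E subrr.
Qed.

Lemma uniton_closed_dzbar :
  d (field_of al) * (1 - field_of al) = field_of al * a * (1 - field_of al).
Proof.
apply: field_eq_cdom => q uq; rewrite !fieldME field1BE // field_ofE //.
rewrite -uniton_Az // field_of_dz //.
have tal : (al q)^t* = al q := (al_proj q).1.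
have E : (1%:M - al q) *m (dzbar u al q + Azbar u Phi q *m al q) = 0.
  apply: eq_mulmx_col => w; rewrite mul0mx.
  have [E _] := uniton_section w uq.
  by rewrite -mulmxA mulmxBl mul1mx mulmxDl -mulmxA E subrr.
have tcM (A B : 'M[C]_n) : (A *m B)^t* = B^t* *m A^t*.
  by rewrite trmx_mul map_mxM.
have tcD (A B : 'M[C]_n) : (A + B)^t* = A^t* + B^t*.
  by rewrite linearD /= map_mxD.
have tcN (A : 'M[C]_n) : (- A)^t* = - A^t* by rewrite linearN /= map_mxN.
have tc1 : (1%:M - al q)^t* = 1%:M - al q.
  by rewrite tcD tcN trmx1 map_mx1 tal.
have alE : (fun q => (al q)^t*) = al by apply/funext => p; exact: (al_proj p).1.
(* The adjoint turns dbar of the self-adjoint [al] into [d al], and A_zbar into minus A_z. *)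
have {E} := congr1 (fun X : 'M[C]_n => X^t*) E.
rewrite uniton_Azbar // dzbarE // alE tcM tc1 tcD tcM tcN !trmxCK tal.
rewrite mulmxN mulmxBl trmx0 map_mx0 => /eqP; rewrite subr_eq0 => /eqP ->.
by [].
Qed.

End Uniton.

Lemma smooth_mul (f g : M -> 'M[C]_n) :
  smooth_on setT f -> smooth_on setT g -> smooth_on setT (fun q => f q *m g q).
Proof.
move=> sf sg v av i j; rewrite setIT; under eq_fun do rewrite mxE.
have o := open_chart_range v; apply: (Cinfty_sum o) => k; apply: (CinftyM o).
  by have := sf v av i k; rewrite setIT.
by have := sg v av k j; rewrite setIT.
Qed.

Lemma smooth_cst (A : 'M[C]_n) : smooth_on setT (fun _ : M => A).
Proof. by move=> v av i j; exact: Cinfty_cst. Qed.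

Lemma smooth_cartan (f : M -> 'M[C]_n) :
  smooth_on setT f -> smooth_on setT (cartan f).
Proof.
move=> sf v av i j; rewrite setIT; have o := open_chart_range v.
have sfij : Cinfty (zcoord v @` cdom v) (fun x => f (cinv v x) i j).
  by have := sf v av i j; rewrite setIT.
apply: (eq_Cinfty o) (CinftyD o (CinftyM o (Cinfty_cst _ 2) sfij)
  (Cinfty_cst _ (- (1%:M : 'M[C]_n) i j))) => x _.
by rewrite /cartan /perp !mxE; ring.
Qed.

Lemma field_of_cartan f : smooth_on setT f ->
  field_of (cartan f) = 2 * field_of f - 1.
Proof.
move=> sf; apply: field_eq_cdom => q uq; rewrite field_ofE //; last exact: smooth_cartan.
rewrite mulr_natl mulr2n fieldDE fieldNE field1E ?fieldDE; last exact: chart_range_zcoord.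
by rewrite field_ofE // /cartan /perp opprB addrA.
Qed.

Lemma field_double_inj (f g : S) : f + f = g + g -> f = g.
Proof.
move=> fg; apply: field_eqP => x _; apply/matrixP => i j.
have /(congr1 (fun h : S => h x i j)) := fg; rewrite !fieldDE !mxE -!mulr2n.
by apply: pmulrnI.
Qed.

(** Induction on the unitons: the constant [phi0] has A_z = 0 and bound 0, and each uniton raises
    the bound by one. *)
Lemma finite_uniton_bounded phi :
  subbundle phi -> finite_uniton_number phi ->
  exists m : int,
    pencil_bounded d ((2 * field_of phi - 1) * d (field_of phi)) m.
Proof.
move=> [phi_smooth phi_proj] [s [phi0 [al [_ al_uniton phiE]]]].
have dD := @field_derD R M u n; have dM := @field_derM R M u n.
have [a aE am] : exists2 a : S,
    d (field_of (uniton_product phi0 al s)) =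
      field_of (uniton_product phi0 al s) * (a + a) &
    pencil_bounded d a s.
  elim: {phiE} s al_uniton => [|s IH] al_uniton.
    exists 0; last exact: pencil_bounded0.
    rewrite addr0 mulr0; apply: field_eq_cdom => q uq.
    rewrite field_of_dz //; last exact: smooth_cst.
    by apply/matrixP => i j; rewrite !mxE wirtinger_cst.
  have [i is_|a aE am] := IH; first by apply: al_uniton; exact: ltnW.
  have al_s := al_uniton s (ltnSn s).
  have [[Ps _ _] [als _] _] := al_s.
  have al_idem := field_of_idem al_s.
  exists (adding_uniton d a (field_of (al s))); last first.
    have -> : (s.+1 : int) = s%:Z + 1 by lia.
    apply: adding_uniton_bounded => //.
      exact (uniton_closed_Az al_s aE).
    exact (uniton_closed_dzbar al_s aE).
  have -> : field_of (uniton_product phi0 al s.+1) =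
      field_of (uniton_product phi0 al s) * (2 * field_of (al s) - 1).
    rewrite -field_of_cartan //; apply: field_eq_cdom => q uq.
    rewrite fieldME !field_ofE //; first exact: smooth_cartan.
    by apply: smooth_mul => //; exact: smooth_cartan.
  exact: der_mul_reflection.
have E : uniton_product phi0 al s = cartan phi.
  by apply/funext => p; rewrite -phiE.
have phi_idem : field_of phi * field_of phi = field_of phi.
  by apply: field_eq_cdom => q uq; rewrite fieldME !field_ofE // (phi_proj q).2.
(* The equation for [a] determines it, since the reflection [2 * field_of phi - 1] is its own
   inverse. *)
exists s; suff <- : a = (2 * field_of phi - 1) * d (field_of phi) by [].
apply: field_double_inj; rewrite -mulrDr -(der_reflection dD dM) -field_of_cartan //.
rewrite -E aE E field_of_cartan // mulrA reflectionK //.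
by rewrite mul1r.
Qed.

End Chart.

(** * The return maps *)

Section NilpotentRank.
Variables (K : fieldType) (n : nat).
Implicit Types A B X D : 'M[K]_n.

Lemma colspace_factor A B : (A^T == B^T)%MS ->
  (exists Y, A = B *m Y) /\ (exists Y, B = A *m Y).
Proof.
case/andP=> /submxP[Y AY] /submxP[Z BZ]; split; [exists Y^T|exists Z^T].
  by rewrite -[LHS]trmxK AY trmx_mul trmxK.
by rewrite -[LHS]trmxK BZ trmx_mul trmxK.
Qed.

(** [B] preserves the column space of [X]. Were the rank not to drop, [B] would map this space onto
    itself, and so would all its powers, against nilpotency. *)
Lemma nilpotent_rank_lt B X D m k : B *m X = X *m D ->
  iter m (mulmx B) X = 0 -> (\rank X <= k.+1)%N -> (\rank (B *m X) <= k)%N.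
Proof.
move=> BX nil rX; rewrite leqNgt; apply/negP => kr.
have eqr : \rank (B *m X)^T = \rank X^T.
  rewrite !mxrank_tr; apply/eqP; rewrite eqn_leq (leq_trans rX kr) andbT.
  exact: mxrankM_maxr.
have sub : ((B *m X)^T <= X^T)%MS by rewrite BX trmx_mul submxMl.
have /eqmxP/andP[_] : ((B *m X)^T :=: X^T)%MS.
  by apply/eqmxP; rewrite -(geq_leqif (mxrank_leqif_eq sub)) eqr.
move=> /submxP[Y XY].
have {}XY : X = B *m X *m Y^T by rewrite -[LHS]trmxK XY trmx_mul trmxK.
have Xi i : exists Z, X = iter i (mulmx B) X *m Z.
  elim: i => [|i [Z IH]]; first by exists 1%:M; rewrite mulmx1.
  by exists (Z *m Y^T); rewrite {1}XY {1}IH iterS !mulmxA.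
have [Z XZ] := Xi m; rewrite nil mul0mx in XZ.
by move: kr; rewrite XZ mulmx0 mxrank0.
Qed.

Lemma nilpotent_iter_rank B X D m k : B *m X = X *m D ->
  iter m (mulmx B) X = 0 -> (\rank X <= k)%N -> iter k (mulmx B) X = 0.
Proof.
elim: k X => [|k IH] X BX nil rX.
  by apply/eqP; rewrite -mxrank_eq0 -leqn0.
rewrite iterSr; apply: IH.
- by rewrite {1}BX mulmxA.
- by rewrite -iterSr iterS nil mulmx0.
- exact: nilpotent_rank_lt BX nil rX.
Qed.
End NilpotentRank.

(** * From generic points to whole charts, and bundle maps as fields *)

Section Generic.
Variables (R : realType) (M : riemann_surface R) (n : nat).
Local Notation C := R[i].
Variable u : chart R M.
Hypothesis u_atlas : atlas u.
Local Notation S := (field_ring u n).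

Lemma field_generic0 (f : S) :
  (forall p, cdom u p ->
     \forall q \near p^', cdom u q -> f (zcoord u q) = 0) -> f = 0.
Proof.
move=> f0; apply: field_eq_cdom => p up; rewrite field0E.
set x := zcoord u p; have rx : chart_range u x := chart_range_zcoord up.
have cx : {for x, continuous (cinv u)} by exact: cinv_continuous.
have near0 : \forall y \near x, y != x -> f y = 0.
  (* The punctured neighbourhood of [p] is pulled back to the plane by the continuous map
     [cinv u]. *)
  have := f0 p up; rewrite /dnbhs near_withinE -{1}(zcoordK up) => /cx N.
  have U := near_open (open_chart_range u) rx.
  have N' : \forall y \near x, cinv u y != p -> cdom u (cinv u y) ->
    f (zcoord u (cinv u y)) = 0 := N.
  move: N' U; apply: filterS2 => y Py [q uq yE] yx.
  move: Py; rewrite /= -yE zcoordK //; apply=> //.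
  by apply/eqP => qp; move: yx; rewrite -yE qp /x eqxx.
apply/matrixP => i j; rewrite [RHS]mxE.
have [[cr _] [ci _]] := field_smooth f i j 0.
have re0 := continuous_punctured0 (cr x rx).
have im0 := continuous_punctured0 (ci x rx).
apply/eqP; rewrite eq_complex /=; apply/andP; split; apply/eqP.
  by apply: re0; apply: filterS near0 => y fy /fy ->; rewrite mxE.
by apply: im0; apply: filterS near0 => y fy /fy ->; rewrite mxE.
Qed.

Lemma field_iterE (f g : S) m x :
  (f ^+ m * g) x = iter m (mulmx (f x)) (g x).
Proof. by elim: m => [|m IH]; rewrite ?mul1r // exprS -mulrA fieldME IH. Qed.

Section Bundles.
Variable G : nat -> M -> 'M[C]_n.
Variable r : nat.
Hypothesis G_sub : forall i, subbundle (G i).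
Local Notation d := (@field_der R M u n).
Local Notation g := (fun i => field_of u (G i)).

Lemma field_GE i q : cdom u q -> g i (zcoord u q) = G i q.
Proof. by move=> uq; rewrite field_ofE //; case: (G_sub i). Qed.

Lemma field_fundform (psi chi : M -> 'M[C]_n) (f h : S) q :
  cdom u q ->
  (forall q, cdom u q -> f (zcoord u q) = psi q) ->
  (forall q, cdom u q -> h (zcoord u q) = chi q) ->
  fundform d f h (zcoord u q) = A' psi chi u q.
Proof.
move=> uq fE hE; rewrite /fundform !fieldME hE // fE // /A'; congr (_ *m _ *m _).
rewrite field_derE; last exact: chart_range_zcoord.
apply/matrixP => i j; rewrite !mxE; apply: near_wirtinger.
apply: filterS (near_open (open_chart_range u) (chart_range_zcoord uq)).
by move=> _ [p up <-]; rewrite fE // zcoordK.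
Qed.

Lemma field_gauss i q : cdom u q -> gauss d g i (zcoord u q) = A'perp (G i) u q.
Proof.
move=> uq; apply: field_fundform => // p up; first exact: field_GE.
by rewrite field1BE // field_GE.
Qed.

Lemma field_chain i q : cdom u q ->
  chain d g i (zcoord u q) = gauss_chain G i u q.
Proof.
move=> uq; elim: i => [|i IH]; first exact: field_GE.
have -> : chain d g i.+1 = gauss d g i * chain d g i by [].
by rewrite fieldME IH field_gauss.
Qed.

Lemma field_rest q : cdom u q -> rest r g (zcoord u q) = remainder G r q.
Proof.
move=> uq; rewrite /rest field1BE // field_sumE; congr (_ - _).
by apply: eq_bigr => i _; rewrite field_GE.
Qed.

Lemma field_return1 q : cdom u q ->
  return1 d r g (zcoord u q) = first_return G r u q.
Proof.
move=> uq; rewrite fieldME field_chain //; congr (_ *m _).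
by apply: field_fundform => // p up; exact: field_GE.
Qed.

Lemma field_return2 q : cdom u q ->
  return2 d r g (zcoord u q) = second_return G r u q.
Proof.
move=> uq; rewrite /second_return /bmul fieldME [X in _ *m X]fieldME.
rewrite field_chain // (@field_fundform (remainder G r) (G 0)) //.
- rewrite (@field_fundform (G r) (remainder G r)) // => p up.
  + exact: field_GE.
  + exact: field_rest.
- by move=> p up; exact: field_rest.
- by move=> p up; exact: field_GE.
Qed.
End Bundles.
End Generic.

(** * Nilpotency and rank estimates for the return maps *)

Section ReturnMaps.
Variables (R : realType) (M : riemann_surface R) (n : nat).
Local Notation C := R[i].
Variable G : nat -> M -> 'M[C]_n.
Variable r : nat.
Hypothesis G_sub : forall i, subbundle (G i).
Hypothesis G_image : forall i, is_image (A'perp (G i)) (G i.+1).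

(** Each second fundamental form maps generically onto the next Gauss bundle, hence so does their
    composition. *)
Lemma gauss_chain_image j p : \forall q \near p^', forall u, atlas u ->
  cdom u q -> exists Y, G j q = gauss_chain G j u q *m Y.
Proof.
elim: j => [|j IH].
  by near=> q => u _ _; exists 1%:M; rewrite mulmx1.
apply: filterS2 IH ((G_image j).2 p) => q IH im u au uq.
have [Y IHY] := IH u au uq.
have [[Z GZ] _] := colspace_factor (im u au uq).
exists (Y *m Z); rewrite GZ /= /bmul -mulmxA [_ *m (Y *m Z)]mulmxA -IHY.
rewrite mulmxA; congr (_ *m _).
by rewrite /A'perp /A' -[RHS]mulmxA ((G_sub j).2 q).2.
Unshelve. all: end_near. Qed.

Lemma gauss_chain_G0 j u p : gauss_chain G j u p *m G 0 p = gauss_chain G j u p.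
Proof.
by elim: j => [|j IH]; [exact: ((G_sub 0).2 p).2|rewrite /= /bmul -mulmxA IH].
Qed.

Lemma first_return_G0 u p : first_return G r u p *m G 0 p = first_return G r u p.
Proof. by rewrite /first_return /bmul -mulmxA gauss_chain_G0. Qed.

Hypothesis r_gt0 : (0 < r)%N.
Hypothesis G0_orth : forall i, (0 < i <= r)%N -> orthogonal_bundles (G 0) (G i).
Hypothesis G0_uniton : finite_uniton_number (G 0).
Hypothesis c_sq : bzero (bmul (first_return G r) (first_return G r)).
Hypothesis c_rank : forall u p, atlas u -> cdom u p ->
  (\rank (first_return G r u p) <= 2)%N.

Section Chart.
Variable u : chart R M.
Hypothesis u_atlas : atlas u.
Local Notation S := (field_ring u n).
Local Notation d := (@field_der R M u n).
Local Notation g := (fun i => field_of u (G i)).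
Local Notation c := (return1 d r g).
Local Notation e := (return2 d r g).

Let dD := @field_derD R M u n.
Let dM := @field_derM R M u n.

Let G_idem i : g i * g i = g i.
Proof.
apply: field_eq_cdom => q uq; rewrite fieldME field_GE //.
exact: ((G_sub i).2 q).2.
Qed.

Let G0G i : (0 < i <= r)%N -> g 0 * g i = 0.
Proof.
move=> ir; apply: field_eq_cdom => q uq; rewrite fieldME !field_GE //.
exact: G0_orth.
Qed.

Let GG0 i : (0 < i <= r)%N -> g i * g 0 = 0.
Proof.
move=> ir; apply: field_eq_cdom => q uq; rewrite fieldME !field_GE //.
have := congr1 (fun X : 'M[C]_n => X^t*) (G0_orth ir q).
rewrite trmx_mul map_mxM trmx0 map_mx0.
by rewrite ((G_sub i).2 q).1 ((G_sub 0).2 q).1.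
Qed.

Let gauss_sub i : (i < r)%N -> g i.+1 * gauss d g i = gauss d g i.
Proof.
move=> ir; apply/eqP; rewrite -subr_eq0; apply/eqP.
apply: field_generic0 => p up; apply: filterS ((G_image i).2 p) => q im uq.
rewrite fieldDE fieldNE fieldME field_gauss // field_GE //.
have [_ [Y ->]] := colspace_factor (im u u_atlas uq).
by rewrite mulmxA ((G_sub i.+1).2 q).2 subrr.
Qed.

(** [c] is [closing] after the chain, and the chain is generically onto [G r], the source of
    [closing]. *)
Lemma closing_eq0 (f : S) : f * c = 0 -> f * closing d r g = 0.
Proof.
move=> fc; apply: field_generic0 => p up.
apply: filterS (gauss_chain_image r p) => q im uq.
have [Y GY] := im u u_atlas uq.
have cG : closing d r g = closing d r g * g r.
  by rewrite /closing /fundform -[RHS]mulrA G_idem.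
rewrite cG mulrA fieldME field_GE // GY -field_chain // mulmxA -!fieldME -mulrA.
by rewrite fieldME -/(return1 d r g) -fieldME fc mul0mx.
Qed.

Lemma return1_sq : c * c = 0.
Proof.
apply: field_eq_cdom => q uq; rewrite fieldME field_return1 //.
exact: (c_sq u_atlas uq).
Qed.

Let bounded : exists m : int, pencil_bounded d ((2 * g 0 - 1) * d (g 0)) m.
Proof. exact (finite_uniton_bounded u_atlas (G_sub 0) G0_uniton). Qed.

Let closing0 : c * closing d r g = 0.
Proof. exact: closing_eq0 return1_sq. Qed.

Let c_rank2 q : cdom u q -> (\rank (c (zcoord u q)) <= 2)%N.
Proof. by move=> uq; rewrite field_return1 //; exact: c_rank. Qed.

Lemma return12_pointwise : exists m, forall q, cdom u q ->
  iter m (mulmx ((c * e : S) (zcoord u q))) (c (zcoord u q)) = 0.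
Proof.
have [m mP] := return12_nilpotent dD dM r_gt0 G_idem G0G GG0 gauss_sub closing0
  bounded return1_sq.
by exists m => q uq; rewrite -field_iterE mP.
Qed.

(** [c * e] preserves the image of [c] and is nilpotent on it; the rank is at most 2, so two
    applications suffice. *)
Lemma return12_sq : c * e * c * e * c = 0.
Proof.
have [m mP] := return12_pointwise; apply: field_eq_cdom => q uq.
set x := zcoord u q.
have BX : (c * e : S) x *m field_val c x = field_val c x *m (e * c : S) x.
  by rewrite -!fieldME !mulrA.
have : (c * e : S) x *m ((c * e : S) x *m field_val c x) = 0 :=
  nilpotent_iter_rank BX (mP q uq) (c_rank2 uq).
by rewrite -!fieldME !mulrA.
Qed.

Lemma rank_return121 q : cdom u q -> (\rank (field_val (c * e * c)%R (zcoord u q)) <= 1)%N.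
Proof.
move=> uq; have [m mP] := return12_pointwise.
set x := zcoord u q.
have BX : (c * e : S) x *m field_val c x = field_val c x *m (e * c : S) x.
  by rewrite -!fieldME !mulrA.
exact: nilpotent_rank_lt BX (mP q uq) (c_rank2 uq).
Qed.

Lemma return122_eq0 : c * e * c * e * e * (c * e * c) = 0.
Proof.
have c12 : c * e * c * e * closing d r g = 0 by apply: closing_eq0; exact: return12_sq.
have [m mP] := return122_nilpotent dD dM r_gt0 G_idem G0G GG0 gauss_sub closing0
  bounded return1_sq return12_sq c12.
apply: field_eq_cdom => q uq.
set x := zcoord u q.
have nil : iter m (mulmx ((c * e * c * e * e : S) x)) ((c * e * c : S) x) = 0.
  by rewrite -field_iterE mP.
(* The image of [c * e * c] is preserved and of rank at most 1, so nilpotent means zero there. *)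
have BX : (c * e * c * e * e : S) x *m (c * e * c : S) x =
    (c * e * c : S) x *m (e * e * (c * e * c) : S) x by rewrite -!fieldME !mulrA.
exact: nilpotent_iter_rank BX nil (rank_return121 uq).
Qed.

End Chart.
End ReturnMaps.

Theorem proposition2p20 (R : realType) (M : riemann_surface R) (n k : nat)
    (phi : M -> 'M[R[i]%C]_n)
    (phi_map : grassmannian_map k phi)
    (phi_harmonic : harmonic_map phi)
    (phi_finite_uniton : finite_uniton_number phi)
    (G : nat -> M -> 'M[R[i]%C]_n)
    (phi_gauss : gauss_bundles phi G)
    (r : nat)
    (phi_isotropy : isotropy_order G r)
    (c : bundle_map M n) (c_def : c = first_return G r)
    (e : bundle_map M n) (e_def : e = second_return G r)
    (c_nilorder : nilorder phi c 2)
    (c_rank : brank c 2)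
    (im_c : M -> 'M[R[i]%C]_n)
    (im_c_def : is_image c im_c)
    (eta : M -> 'M[R[i]%C]_n)
    (eta_def : is_image (brestrict (bmul c e) im_c) eta)
    (F : bundle_map M n)
    (F_def : F = brestrict (bmul c (bmul e (bmul c (bmul e e)))) eta) :
  bnilpotent eta F /\ bzero F.
Proof.
have [G0 G_image] := phi_gauss; have [r_gt0 G0_orth _] := phi_isotropy.
have G_sub i : subbundle (G i).
  by case: i => [|i]; [rewrite G0; case: phi_map|case: (G_image i)].
subst phi c e.
have c_sq : bzero (bmul (first_return G r) (first_return G r)).
  move=> u p au up; have [+ _] := c_nilorder => /(_ u p au up).
  by rewrite /bpow /= first_return_G0.
have F0 : bzero F.
  move=> u p au up.
  have eta_smooth : smooth_on setT eta by case: eta_def => -[].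
  have [cc [ee [ccE eeE E]]] : exists cc ee : field_ring u n, [/\
      forall q, cdom u q -> cc (zcoord u q) = first_return G r u q,
      forall q, cdom u q -> ee (zcoord u q) = second_return G r u q
    & cc * ee * cc * ee * ee * (cc * ee * cc) = 0].
    exists (return1 (@field_der R M u n) r (fun i => field_of u (G i))).
    exists (return2 (@field_der R M u n) r (fun i => field_of u (G i))).
    split=> [q uq|q uq|]; first exact: field_return1.
      exact: field_return2.
    by apply: return122_eq0 => //; exact: c_rank.1.
  (* At generic points [eta] factors through [c e c], where [return122_eq0] applies; continuity
     gives the other points. *)
  have z : cc * (ee * (cc * (ee * ee))) * field_of u eta = 0.
    apply: field_generic0 => q uq.
    apply: filterS2 (im_c_def.2 q) (eta_def.2 q) => x imx etax ux.
    have [[Y1 E1] _] := colspace_factor (etax u au ux).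
    have [[Y2 E2] _] := colspace_factor (imx u au ux).
    rewrite fieldME field_ofE // E1 /brestrict /bmul E2 -ccE // -eeE //.
    rewrite !mulmxA -!fieldME !mulrA; rewrite !mulrA in E.
    by rewrite E !mul0mx.
  have := congr1 (fun f : field_ring u n => f (zcoord u p)) z.
  by rewrite !fieldME field_ofE // ccE // eeE // F_def field0E.
split=> //; exists 1 => u p au up.
by rewrite /bpow /= F0 // mul0mx.
Qed.
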